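(* Let $m,n\ge 2$, let $\mathbf{k}$ be a finite field, and let $C\subseteq\mathbf{k}^{m\times n}$ be an $(m,n,a=2,b=2)$ maximally recoverable tensor code. An erasure pattern $E\subseteq[m]\times[n]$ is correctable for $C$ if and only if $E$, viewed as (the edge set of) a bipartite graph on $[m]\sqcup[n]$, has an edge orientation with no directed cycles and no alternating cycles.
   Context: Write $[n]=\{1,\dots,n\}$. Tensor matroid: for integers $0\le s\le m$, $0\le r\le n$ and $p$ equal to $0$ or a prime, let $K$ be a field of characteristic $p$ and let $u_1,\dots,u_m\in K^s$, $v_1,\dots,v_n\in K^r$ be vectors all of whose coordinates together are algebraically independent over the prime field. $\mathrm{T}_{m,n}(s,r,p)$ is the matroid on $[m]\times[n]$ in which $E$ is independent if and only if the vectors $u_i\otimes v_j$, $(i,j)\in E$, are linearly independent in $K^s\otimes K^r$. Tensor codes: let $\mathbf{k}$ be a finite field of characteristic $p$. Given subspaces $C_{\rm col}\subseteq\mathbf{k}^m$ of dimension $m-a$ and $C_{\rm row}\subseteq\mathbf{k}^n$ of dimension $n-b$, the tensor code is $C=C_{\rm col}\otimes C_{\rm row}\subseteq\mathbf{k}^{m\times n}$, i.e. the space of matrices all of whose columns lie in $C_{\rm col}$ and all of whose rows lie in $C_{\rm row}$. The code $C$ is an $(m,n,a,b)$ maximally recoverable tensor code if it realizes $\mathrm{T}_{m,n}(m-a,n-b,p)$, i.e. the matroid on $[m]\times[n]$ represented by the coordinate functionals on $C$ (where $F$ is independent if and only if the coordinate projection $C\to\mathbf{k}^F$ is surjective) equals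 $\mathrm{T}_{m,n}(m-a,n-b,p)$. An erasure pattern $E\subseteq[m]\times[n]$ is correctable if every codeword of $C$ is uniquely determined by its entries outside $E$, i.e. no nonzero codeword is supported in $E$. Given an orientation of the edges of a graph, a directed cycle is a cycle which is consistently oriented, and an alternating cycle is a cycle whose edges alternate in orientation as one traverses the cycle. *)

(* Defs.v *)
From mathcomp Require Import all_boot all_order all_algebra.
From mathcomp Require Import mpoly.

Set Implicit Arguments.
Unset Strict Implicit.
Unset Printing Implicit Defensive.

Import GRing.Theory.
Local Open Scope ring_scope.

Definition has_characteristic (K : fieldType) (p : nat) : Prop :=
  if p == 0%N then [pchar K] =i pred0 else p \in [pchar K].

Definition in_prime_field (K : fieldType) (x : K) : Prop :=
  exists a b : int, b%:~R != 0 :> K /\ x = a%:~R / b%:~R.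

Definition alg_independent (K : fieldType) (N : nat) (x : 'rV[K]_N) : Prop :=
  forall f : {mpoly K[N]},
    (forall mon, in_prime_field f@_mon) -> f.@[x 0] = 0 -> f = 0.

(* K^s ⊗ K^r is modelled by 'M[K]_(s, r), with u ⊗ v the outer product. *)
Definition tensor_vec (K : fieldType) (s r : nat) (u : 'rV[K]_s) (v : 'rV[K]_r)
    : 'M[K]_(s, r) :=
  u^T *m v.

(* [I] is the family of independent sets of T_{m,n}(s, r, p).  The vectors u_i
   and v_j are the rows of U and V.  The matroid does not depend on the choice
   of K, U and V, so we ask that [I] be the one given by some choice. *)
Definition is_tensor_matroid (m n s r p : nat) (I : {set 'I_m * 'I_n} -> Prop)
    : Prop :=
  exists (K : fieldType) (U : 'M[K]_(m, s)) (V : 'M[K]_(n, r)),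
    [/\ has_characteristic K p,
        alg_independent (row_mx (mxvec U) (mxvec V)) &
        forall E : {set 'I_m * 'I_n},
          I E <->
          free [seq tensor_vec (row e.1 U) (row e.2 V) | e <- enum E]].

Section Codes.
Variables (k : fieldType) (m n : nat).
Implicit Types (C : {vspace 'M[k]_(m, n)}) (E F : {set 'I_m * 'I_n}).

Definition tensor_code (Ccol : {vspace 'cV[k]_m}) (Crow : {vspace 'rV[k]_n})
    : {vspace 'M[k]_(m, n)} :=
  ((\bigcap_(j < n) (linfun (@col k m n j) @^-1: Ccol)) :&:
   (\bigcap_(i < m) (linfun (@row k m n i) @^-1: Crow)))%VS.

Lemma mem_tensor_code (Ccol : {vspace 'cV[k]_m}) (Crow : {vspace 'rV[k]_n})
    (M : 'M[k]_(m, n)) :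
  reflect ((forall j, col j M \in Ccol) /\ (forall i, row i M \in Crow))
          (M \in tensor_code Ccol Crow).
Proof.
rewrite memv_cap; apply: (iffP andP).
  rewrite !memvE => -[/subv_bigcapP hc /subv_bigcapP hr]; split=> [j|i].
    by have := hc j isT; rewrite -memvE -memv_preim lfunE.
  by have := hr i isT; rewrite -memvE -memv_preim lfunE.
case=> hc hr; rewrite !memvE; split; apply/subv_bigcapP=> i _.
  by rewrite -memvE -memv_preim lfunE; apply: hc.
by rewrite -memvE -memv_preim lfunE; apply: hr.
Qed.

(* The projection C -> k^F is surjective; a target vector in k^F is given as
   the restriction to F of an arbitrary matrix Y. *)
Definition code_indep C F : Prop :=
  forall Y : 'M[k]_(m, n),
    exists2 M, M \in C & forall e, e \in F -> M e.1 e.2 = Y e.1 e.2.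

Definition correctable C E : Prop :=
  forall M M', M \in C -> M' \in C ->
    (forall e, e \notin E -> M e.1 e.2 = M' e.1 e.2) -> M = M'.

(* [p] is meant to be the characteristic of k, with a <= m and b <= n. *)
Definition mr_tensor_code (p a b : nat) C : Prop :=
  exists (Ccol : {vspace 'cV[k]_m}) (Crow : {vspace 'rV[k]_n}),
    [/\ \dim Ccol = (m - a)%N, \dim Crow = (n - b)%N,
        C = tensor_code Ccol Crow &
        is_tensor_matroid (m - a) (n - b) p (code_indep C)].

End Codes.

Definition bip_graph (m n : nat) (E : {set 'I_m * 'I_n}) : rel ('I_m + 'I_n) :=
  fun x y => match x, y with
             | inl i, inr j | inr j, inl i => (i, j) \in E
             | _, _ => false
             end.

Section Orientations.
Variable V : eqType.

(* [d x y] means that the edge xy is directed from x to y. *)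
Definition orientation (g d : rel V) : Prop :=
  (forall x y, g x y = d x y || d y x) /\ (forall x y, ~~ (d x y && d y x)).

(* A cycle is listed by its distinct vertices in order; [next c x] is the
   cyclic successor of x in c. *)
Definition graph_cycle (g : rel V) (c : seq V) : Prop :=
  (2 < size c)%N /\ ucycle g c.

Definition directed_cycle (g d : rel V) (c : seq V) : Prop :=
  graph_cycle g c /\ forall x, x \in c -> d x (next c x).

Definition alternating_cycle (g d : rel V) (c : seq V) : Prop :=
  graph_cycle g c /\
  forall x, x \in c ->
    d x (next c x) != d (next c x) (next c (next c x)).

End Orientations.

(* Main.v *)
Require Import Defs.
From HB Require Import structures.
From mathcomp Require Import mpoly.
From mathcomp Require Import all_boot all_order all_algebra.
From mathcomp Require Import ring.
From Stdlib Require Import Classical.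

(* Dually to the tensor matroid, [E] is correctable iff there is no nonzero matrix
   [X] supported on [E] with [A^T X = 0] and [X B = 0], for generic [A] and [B] with
   two columns; equivalently, the differentials of the brackets [det (a_i, b_j)],
   [(i, j) \in E], are linearly independent.

   Given an acyclic orientation, rank the vertices accordingly and degenerate to
   [a_i = (1, t^(rk i))], [b_j = (1, t^(rk j))].  As [t] tends to 0 the equations on
   [X] become: at each vertex, the incoming and the outgoing edges both have total
   weight zero.  The edges directed from left to right, and those directed from right
   to left, form forests since there are no alternating cycles, whence [X = 0].

   Conversely, if the differentials are independent, then so are algebraically the
   brackets of suitable perturbed points.  Chevalley's theorem then yields a valuation
   for which the values of these brackets are linearly independent over the integers.
   The differences of the slopes of the points form an ultrametric, hence a binary
   tree such that no nonzero circulation on [E] has sum zero across every node of the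
   tree.  Tree rotations preserving this property turn the tree into a caterpillar,
   i.e. a linear order of the vertices; an alternating cycle for the orientation
   given by this order would be a circulation contradicting the property. *)

Set Implicit Arguments.
Unset Strict Implicit.
Unset Printing Implicit Defensive.

Import Order.TTheory GRing.Theory.
Local Open Scope ring_scope.

(** * Matroids of codes *)

Section CodeMatroid.
Variables (k : fieldType) (m n : nat).
Implicit Types (C : {vspace 'M[k]_(m, n)}) (E F : {set 'I_m * 'I_n}).

(** A multiple of [M] adjusts the entry at [e] without disturbing those on [F]. *)
Lemma code_indepU1 C F M e :
  M \in C -> (forall f, f \in F -> M f.1 f.2 = 0) -> M e.1 e.2 != 0 ->
  code_indep C F -> code_indep C (e |: F).
Proof.
move=> MC MF Me iF Y; have [M1 M1C M1F] := iF Y.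
pose a := (Y e.1 e.2 - M1 e.1 e.2) / M e.1 e.2.
exists (M1 + a *: M); first by rewrite rpredD ?rpredZ.
move=> f; rewrite !mxE => /setU1P [-> | fF]; last by rewrite MF // mulr0 addr0 M1F.
by rewrite divfK // addrC subrK.
Qed.

(* A set is correctable iff its complement is spanning, i.e. contains a basis
   of the matroid of the code. *)
Lemma correctable_basis C E :
  correctable C E <->
  exists F : {set 'I_m * 'I_n},
    [/\ F \subset ~: E, code_indep C F &
        forall e, e \notin F -> ~ code_indep C (e |: F)].
Proof.
split=> [cE | [F [FE iF maxF]] M M' MC M'C eqM]; last first.
  apply/matrixP=> i j; apply/eqP; rewrite -subr_eq0; apply/negPn/negP => neq.
  have MM'C : M - M' \in C by rewrite rpredB.
  have MM'F f : f \in F -> (M - M') f.1 f.2 = 0.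
    move=> fF; rewrite !mxE eqM ?subrr //.
    by have := subsetP FE f fF; rewrite inE.
  have nF : (i, j) \notin F.
    by apply/negP => /MM'F /=; rewrite !mxE => e0; rewrite e0 eqxx in neq.
  by apply: (maxF _ nF); apply: (code_indepU1 MM'C); rewrite ?mxE.
have cE0 M : M \in C -> M != 0 -> exists2 e, e \notin E & M e.1 e.2 != 0.
  move=> MC Mn0.
  have [e /andP[? ?] | nex] := pickP [pred e | (e \notin E) && (M e.1 e.2 != 0)].
    by exists e.
  case/eqP: Mn0; apply: cE => //; first exact: mem0v.
  by move=> e eE; have := nex e; rewrite /= eE /= mxE => /negbFE /eqP.
have [F [[FE iF] maxF]] : exists F : {set 'I_m * 'I_n},
    (F \subset ~: E /\ code_indep C F) /\
    forall e, e \notin E -> e \notin F -> ~ code_indep C (e |: F).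
  (* [F] is grown greedily inside the complement of [E]; the measure counts the positions outside
     [E] that it still misses. *)
  have [d] := ubnP #|~: E :\: set0|.
  have : (set0 : {set 'I_m * 'I_n}) \subset ~: E by rewrite sub0set.
  have : code_indep C set0 by move=> Y; exists 0; [exact: mem0v | move=> e; rewrite inE].
  elim: d set0 => // d IHd F iF FE; rewrite ltnS => le_d.
  have [[e [eE eF ieF]] | nex] :=
      classic (exists e, [/\ e \notin E, e \notin F & code_indep C (e |: F)]).
    apply: (IHd (e |: F)) => //; first by rewrite subUset sub1set inE eE.
    apply: leq_trans le_d; apply: proper_card; rewrite setDUr.
    apply/properP; split; first by apply/subsetP=> x; rewrite !inE => /andP[_].
    by exists e; rewrite !inE ?eE ?eF ?eqxx.
  by exists F; split=> // e eE eF ieF; apply: nex; exists e.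
exists F; split=> // e eF ieF.
have [eE | eE] := boolP (e \in E); last exact: maxF eE eF ieF.
(* If [e] in [E] could be added to [F], some codeword would vanish on [F] and equal 1 at [e]. By
   correctability it has a nonzero entry at some [f] outside [E], so [F] could be enlarged by [f],
   against its maximality. *)
have [M MC Me] := ieF (delta_mx e.1 e.2).
have Mn0 : M != 0.
  apply/eqP => M0; have := Me e (setU11 _ _); rewrite M0 !mxE !eqxx.
  by move/eqP; rewrite eq_sym oner_eq0.
have [f fE Mf] := cE0 M MC Mn0.
have MF g : g \in F -> M g.1 g.2 = 0.
  move=> gF; rewrite Me ?setU1r // mxE.
  case: eqP => //= e1; case: eqP => //= e2; case/negP: eF.
  by rewrite [e]surjective_pairing -e1 -e2 -surjective_pairing.
apply: (maxF f) => //; last exact: code_indepU1 MC MF Mf iF.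
by apply/negP => /MF f0; rewrite f0 eqxx in Mf.
Qed.

End CodeMatroid.

(** * Codes with given generator matrices *)

Section GenericCode.
Variables (K : fieldType) (m n s r : nat) (U : 'M[K]_(m, s)) (V : 'M[K]_(n, r)).

Definition mulmx_lr (B : 'M[K]_(s, r)) : 'M[K]_(m, n) := U *m B *m V^T.

Lemma mulmx_lr_linear : linear mulmx_lr.
Proof. by move=> a B B'; rewrite /mulmx_lr mulmxDr mulmxDl -scalemxAr -scalemxAl. Qed.
HB.instance Definition _ := GRing.isLinear.Build K _ _ _ mulmx_lr mulmx_lr_linear.

Definition image_code : {vspace 'M[K]_(m, n)} := limg (linfun mulmx_lr).

Lemma image_codeP M : reflect (exists B, M = U *m B *m V^T) (M \in image_code).
Proof.
apply: (iffP memv_imgP) => [[B _ ->] | [B ->]]; exists B; rewrite ?memvf ?lfunE //.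
Qed.

Lemma mulmx_lrE B i j :
  (U *m B *m V^T) i j = \sum_a \sum_b B a b * tensor_vec (row i U) (row j V) a b.
Proof.
rewrite !mxE exchange_big; apply: eq_bigr => b _; rewrite !mxE mulr_suml.
by apply: eq_bigr => a _; rewrite !mxE big_ord1 !mxE mulrA [B _ _ * _]mulrC.
Qed.

(** An entry of [U *m B *m V^T] is the pairing of [B] with a tensor vector, and a family is free iff
    its pairings with some [B] can be prescribed at will. *)
Lemma free_tensor_vec (F : {set 'I_m * 'I_n}) :
  free [seq tensor_vec (row e.1 U) (row e.2 V) | e <- enum F] <->
  code_indep image_code F.
Proof.
set T := fun e : 'I_m * 'I_n => tensor_vec (row e.1 U) (row e.2 V).
pose t := [tuple of map T (enum_tuple F)].
have tE : [seq T e | e <- enum F] = t by [].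
rewrite tE; split=> [fr Y | iF].
  pose y i := Y (enum_val i).1 (enum_val (i : 'I_#|F|)).2.
  (* A linear form with the prescribed values on the free family; [B] below represents it through
     the pairing of matrices. *)
  pose phi (X : 'M[K]_(s, r)) := \sum_(i < #|F|) coord t i X * y i.
  have phiZ a X X' : phi (a *: X + X') = a * phi X + phi X'.
    rewrite /phi mulr_sumr -big_split; apply: eq_bigr => i _ /=.
    by rewrite linearP mulrDl mulrA.
  have phi0 : phi 0 = 0 by rewrite /phi big1 // => i _; rewrite linear0 mul0r.
  have phis (I : finType) (c : I -> K) (X : I -> 'M_(s, r)) :
      phi (\sum_i c i *: X i) = \sum_i c i * phi (X i).
    by elim/big_rec2: _ => // i a b _ <-; rewrite phiZ.
  pose B := \matrix_(a, b) phi (delta_mx a b).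
  exists (U *m B *m V^T); first by apply/image_codeP; exists B.
  move=> e eF; rewrite mulmx_lrE pair_bigA /=.
  transitivity (phi (T e)).
    rewrite {1}[T e]matrix_sum_delta pair_bigA phis; apply: eq_bigr => -[a b] _ /=.
    by rewrite mxE mulrC.
  have et : T e = t`_(enum_rank_in eF e).
    rewrite -tnth_nth tnth_map (tnth_nth e) /= -enum_val_nth enum_rankK_in //.
  rewrite /phi et (bigD1 (enum_rank_in eF e)) //= big1 => [|i ne].
    by rewrite coord_free // eqxx mul1r addr0 /y enum_rankK_in.
  by rewrite coord_free // eq_sym (negPf ne) mul0r.
apply/freeP => c sum0 i.
(* This [B] pairs to 1 with the [i]-th vector and to 0 with the others, so pairing it with the
   relation extracts [c i]. *)
have [M /image_codeP[B ->] BE] := iF (delta_mx (enum_val i).1 (enum_val i).2).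
have ti (j : 'I_#|F|) : t`_j = T (enum_val j).
  by rewrite -tnth_nth tnth_map (tnth_nth (enum_val j)) /= -enum_val_nth.
have S (j : 'I_#|F|) : \sum_p B p.1 p.2 * t`_j p.1 p.2 = (j == i)%:R.
  rewrite ti; have := BE (enum_val j) (enum_valP j).
  rewrite mulmx_lrE pair_bigA /= => ->; rewrite mxE -(inj_eq enum_val_inj).
  by rewrite -xpair_eqE -!surjective_pairing.
have : \sum_p B p.1 p.2 * (\sum_(j < #|F|) c j *: t`_j) p.1 p.2 = 0.
  by rewrite sum0 big1 // => p _; rewrite mxE mulr0.
under eq_bigr => p _ do rewrite summxE mulr_sumr.
rewrite exchange_big /= (eq_bigr (fun j => c j * (j == i)%:R)) => [|j _].
  rewrite (bigD1 i) //= eqxx mulr1 big1 ?addr0 // => j /negPf->.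
  by rewrite mulr0.
by rewrite -S mulr_sumr; apply: eq_bigr => p _; rewrite mxE mulrCA.
Qed.

End GenericCode.

(* Both matroids have the same bases, so [E] is correctable for [C] iff it is
   for the code represented by the generic vectors. *)
Lemma mr_tensor_code_correctable (k : fieldType) (m n p a b : nat)
    (C : {vspace 'M[k]_(m, n)}) : mr_tensor_code p a b C ->
  exists (K : fieldType) (U : 'M[K]_(m, m - a)) (V : 'M[K]_(n, n - b)),
    [/\ has_characteristic K p, alg_independent (row_mx (mxvec U) (mxvec V)) &
        forall E, correctable C E <-> correctable (image_code U V) E].
Proof.
case=> Ccol [Crow [_ _ _ [K [U [V [hK hUV hI]]]]]]; exists K, U, V; split=> // E.
have eqI F : code_indep C F <-> code_indep (image_code U V) F.
  by rewrite hI free_tensor_vec.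
rewrite !correctable_basis; split=> -[F [FE iF maxF]]; exists F; split=> //.
- exact/eqI.
- by move=> e eF /eqI; apply: maxF.
- exact/eqI.
- by move=> e eF /eqI; apply: maxF.
Qed.

(** * Genericity *)

(** Arbitrary finite index types allow equations of several kinds to be gathered in a sum type
    [J]. *)
Definition injective_system (F : fieldType) (I J : finType) (q : I -> J -> F) :=
  forall y : I -> F, (forall j, \sum_i y i * q i j = 0) -> forall i, y i = 0.

Lemma injective_system_row_free (F : fieldType) (I J : finType) (q : I -> J -> F) :
  injective_system q <->
  row_free (\matrix_(i < #|I|, j < #|J|) q (enum_val i) (enum_val j)).
Proof.
set Q := matrix_of_fun _ _.
have QE (v : 'rV[F]_#|I|) j :
    (v *m Q) 0 (enum_rank j) = \sum_i v 0 (enum_rank i) * q i j.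
  rewrite mxE (reindex enum_rank) /=; last exact/onW_bij/enum_rank_bij.
  by apply: eq_bigr => i _; rewrite mxE !enum_rankK.
split=> [inj | fr y y0 i].
  apply: inj_row_free => v v0; apply/rowP => i; rewrite mxE -[i]enum_valK.
  apply: (inj (fun i => v 0 (enum_rank i))) => j.
  by rewrite -QE v0 mxE.
have y0' : (\row_(i < #|I|) y (enum_val i)) *m Q = 0.
  apply/rowP => j; rewrite -[j]enum_valK QE mxE -[RHS](y0 (enum_val j)).
  by apply: eq_bigr => i' _; rewrite mxE enum_rankK.
have : \row_(i < #|I|) y (enum_val i) = 0.
  move/sub_kermxP: y0'; move: fr; rewrite -kermx_eq0 => /eqP ->.
  by rewrite submx0 => /eqP.
by move/rowP/(_ (enum_rank i)); rewrite !mxE enum_rankK.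
Qed.

(* Lower semicontinuity of the rank: a minor that does not vanish under [psi]
   does not vanish under [phi]. *)
Lemma injective_system_specialization (R : comNzRingType) (F1 F2 : fieldType)
    (phi : {rmorphism R -> F1}) (psi : {rmorphism R -> F2}) :
  (forall a, phi a = 0 -> psi a = 0) ->
  forall (I J : finType) (q : I -> J -> R),
  injective_system (fun i j => psi (q i j)) ->
  injective_system (fun i j => phi (q i j)).
Proof.
move=> ker I J q /injective_system_row_free fr; apply/injective_system_row_free.
pose Q := \matrix_(i < #|I|, j < #|J|) q (enum_val i) (enum_val j).
have mapE (F : fieldType) (f : R -> F) :
    (\matrix_(i, j) f (q (enum_val i) (enum_val j))) = map_mx f Q.
  by apply/matrixP=> i j; rewrite !mxE.
rewrite (mapE _ phi); rewrite (mapE _ psi) in fr.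
have frT : row_full (map_mx psi Q)^T by rewrite /row_full mxrank_tr.
pose f := fullrankfun frT.
have det_psi : psi (\det (rowsub f Q^T)) != 0.
  rewrite -det_map_mx -unitfE -unitmxE.
  suff -> : map_mx psi (rowsub f Q^T) = rowsub f (map_mx psi Q)^T.
    exact: fullrowsub_unit.
  by apply/matrixP=> i j; rewrite !mxE.
have det_phi : phi (\det (rowsub f Q^T)) != 0.
  by apply: contraNneq det_psi => /ker ->.
rewrite -det_map_mx -unitfE -unitmxE -row_full_unit /row_full in det_phi.
rewrite /row_free -mxrank_tr eqn_leq rank_leq_col -{1}(eqP det_phi).
have -> : map_mx phi (rowsub f Q^T) = rowsub f (map_mx phi Q)^T.
  by apply/matrixP=> i j; rewrite !mxE.
by apply: mxrankS; apply: rowsub_sub.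
Qed.

(** An integral relation at a generic point has all its coefficients zero in [K], hence in [L]
    through [h]. *)
Lemma alg_independent_eval0 (K L : fieldType) (h : {rmorphism K -> L}) (N : nat)
    (x : 'rV[K]_N) (x' : 'rV[L]_N) (f : {mpoly int[N]}) :
  alg_independent x -> mmap intr (x 0) f = 0 -> mmap intr (x' 0) f = 0.
Proof.
move=> ind fx0.
have g0 : map_mpoly intr f = 0 :> {mpoly K[N]}.
  apply: ind => [mon|].
    by exists f@_mon, 1; rewrite mcoeff_map_mpoly divr1 oner_eq0.
  rewrite -[RHS]fx0 /map_mpoly [mmap _ _ f]/mmap [RHS]/mmap raddf_sum.
  by apply: eq_bigr => mon _; rewrite /= mevalM mevalC mmap1_id mevalX.
apply: big1 => mon _; move/(congr1 (mcoeff mon)): g0.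
rewrite mcoeff_map_mpoly mcoeff0 => c0.
by rewrite -(rmorph_int h) c0 rmorph0 mul0r.
Qed.

Section GenericVectors.
Variables (K L : fieldType) (h : {rmorphism K -> L}) (m n s r : nat).
Variables (U : 'M[K]_(m, s)) (V : 'M[K]_(n, r)).
Hypothesis ind : alg_independent (row_mx (mxvec U) (mxvec V)).

Let N := (m * s + n * r)%N.
Let XU i a : {mpoly int[N]} := 'X_(lshift _ (mxvec_index i a)).
Let XV j b : {mpoly int[N]} := 'X_(rshift _ (mxvec_index j b)).

Let evalU (F : fieldType) (U0 : 'M[F]_(m, s)) (V0 : 'M[F]_(n, r)) i a :
  mmap intr (row_mx (mxvec U0) (mxvec V0) 0) (XU i a) = U0 i a.
Proof. by rewrite mmapX mmap1U row_mxEl mxvecE. Qed.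

Let evalV (F : fieldType) (U0 : 'M[F]_(m, s)) (V0 : 'M[F]_(n, r)) j b :
  mmap intr (row_mx (mxvec U0) (mxvec V0) 0) (XV j b) = V0 j b.
Proof. by rewrite mmapX mmap1U row_mxEr mxvecE. Qed.

(** Reduces a generic statement to exhibiting one special point over an extension of [K]. *)
Lemma generic_injective_system (U' : 'M[L]_(m, s)) (V' : 'M[L]_(n, r))
    (I J : finType) (q : I -> J -> {mpoly int[N]}) :
  injective_system (fun i j => mmap intr (row_mx (mxvec U') (mxvec V') 0) (q i j)) ->
  injective_system (fun i j => mmap intr (row_mx (mxvec U) (mxvec V) 0) (q i j)).
Proof.
by apply: injective_system_specialization => a; apply: (alg_independent_eval0 h).
Qed.

Lemma generic_full_rankl : (s <= m)%N -> \rank U = s.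
Proof.
move=> le_sm.
have : injective_system (fun a i => mmap intr (row_mx (mxvec U) (mxvec V) 0) (XU i a)).
  apply: (@generic_injective_system (pid_mx s) 0) => y y0 a.
  have := y0 (widen_ord le_sm a); rewrite (bigD1 a) //= big1 => [|b ne].
    by rewrite evalU mxE /= eqxx ltn_ord mulr1 addr0.
  by rewrite evalU mxE -[_ == _]/(a == b) eq_sym (negPf ne) mulr0.
move=> inj; rewrite -mxrank_tr; apply/eqP/inj_row_free => v v0; apply/rowP => a.
rewrite mxE; apply: (inj (v 0)) => i.
have := congr1 (fun u : 'rV_m => u 0 i) v0; rewrite !mxE => vi0; rewrite -[RHS]vi0.
by apply: eq_bigr => b _; rewrite evalU mxE.
Qed.

Lemma generic_full_rankr : (r <= n)%N -> \rank V = r.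
Proof.
move=> le_rn.
have : injective_system (fun b j => mmap intr (row_mx (mxvec U) (mxvec V) 0) (XV j b)).
  apply: (@generic_injective_system 0 (pid_mx r)) => y y0 a.
  have := y0 (widen_ord le_rn a); rewrite (bigD1 a) //= big1 => [|b ne].
    by rewrite evalV mxE /= eqxx ltn_ord mulr1 addr0.
  by rewrite evalV mxE -[_ == _]/(a == b) eq_sym (negPf ne) mulr0.
move=> inj; rewrite -mxrank_tr; apply/eqP/inj_row_free => v v0; apply/rowP => a.
rewrite mxE; apply: (inj (v 0)) => i.
have := congr1 (fun u : 'rV_n => u 0 i) v0; rewrite !mxE => vi0; rewrite -[RHS]vi0.
by apply: eq_bigr => b _; rewrite evalV mxE.
Qed.

(** Quantifying over [B] rather than over codewords gives a linear system with polynomial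
    coefficients; it also forces [B] to be determined by its codeword. *)
Definition no_codeword_in (F : fieldType) (E : {set 'I_m * 'I_n})
    (U0 : 'M[F]_(m, s)) (V0 : 'M[F]_(n, r)) :=
  forall B : 'M[F]_(s, r),
    (forall e, e \notin E -> (U0 *m B *m V0^T) e.1 e.2 = 0) -> B = 0.

Lemma generic_no_codeword (E : {set 'I_m * 'I_n})
    (U' : 'M[L]_(m, s)) (V' : 'M[L]_(n, r)) :
  no_codeword_in E U' V' -> no_codeword_in E U V.
Proof.
move=> inj'.
pose q (p : 'I_s * 'I_r) (e : 'I_m * 'I_n) : {mpoly int[N]} :=
  XU e.1 p.1 * XV e.2 p.2 *+ (e \notin E).
have qE (F : fieldType) (U0 : 'M[F]_(m, s)) (V0 : 'M[F]_(n, r)) (B : 'M_(s, r)) e :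
    \sum_p B p.1 p.2 * mmap intr (row_mx (mxvec U0) (mxvec V0) 0) (q p e) =
    (U0 *m B *m V0^T) e.1 e.2 *+ (e \notin E).
  rewrite mulmx_lrE pair_bigA /= -sumrMnl; apply: eq_bigr => p _.
  by rewrite rmorphMn rmorphM /= evalU evalV !mxE big_ord1 !mxE !mulrnAr.
have inj : injective_system
    (fun p e => mmap intr (row_mx (mxvec U) (mxvec V) 0) (q p e)).
  apply: (@generic_injective_system U' V') => y y0 p.
  have : \matrix_(a, b) y (a, b) = 0.
    apply: inj' => e eE; rewrite -[LHS]mulr1n -[1%N]/(nat_of_bool true) -eE -qE -[RHS](y0 e).
    by apply: eq_bigr => -[a b] _; rewrite mxE.
  by move/matrixP/(_ p.1 p.2); rewrite !mxE -surjective_pairing.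
move=> B B0; apply/matrixP=> a b; rewrite mxE.
apply: (inj (fun p => B p.1 p.2) _ (a, b)) => e; rewrite qE.
by case: (boolP (e \in E)) => // eE; rewrite B0.
Qed.

End GenericVectors.

(** * Bipartite rigidity *)

Section Orthogonal.
Variable K : fieldType.

(** The columns of [A] form a basis of the orthogonal of the column space of [U], and by dimension
    their own orthogonal is that column space. *)
Lemma left_kernel_basis (m s d : nat) (U : 'M[K]_(m, s)) :
  \rank U = s -> (s + d)%N = m ->
  exists A : 'M[K]_(m, d),
    forall p (X : 'M_(m, p)), A^T *m X = 0 -> exists Y, X = U *m Y.
Proof.
move=> rU sdm.
have rk : \rank (kermx U) = d by rewrite mxrank_ker rU -sdm addKn.
have [N [NU rN]] : exists N : 'M[K]_(d, m), N *m U = 0 /\ \rank N = d.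
  move: rk (row_base (kermx U)) (eq_row_base (kermx U)).
  move: (\rank _) => k -> {k} N eqN; exists N; split.
    by apply/sub_kermxP; rewrite eqN.
  by rewrite eqN mxrank_ker rU -sdm addKn.
exists N^T => p X; rewrite trmxK => NX.
have UN : (U^T <= kermx N^T)%MS by apply/sub_kermxP; rewrite -trmx_mul NU trmx0.
have /eqmxP eqUN : (U^T == kermx N^T)%MS.
  by rewrite -(mxrank_leqif_eq UN) mxrank_ker !mxrank_tr rU rN -sdm addnK.
have /submxP[Y XY] : (X^T <= U^T)%MS.
  by rewrite eqUN; apply/sub_kermxP; rewrite -trmx_mul NX trmx0.
by exists Y^T; rewrite -[X]trmxK XY trmx_mul trmxK.
Qed.

(** As [A] may have rank below [d], its left kernel has dimension at least [s]; only [s] vectors of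
    a basis are kept. *)
Lemma left_kernel_full_rank (m s d : nat) (A : 'M[K]_(m, d)) : (s + d)%N = m ->
  exists2 U : 'M[K]_(m, s), \rank U = s & A^T *m U = 0.
Proof.
move=> sdm; set N := kermx A.
have le_s : (s <= \rank N)%N.
  by rewrite mxrank_ker -{1}(addnK d s) sdm leq_sub2l ?rank_leq_col.
exists (pid_mx s *m row_base N)^T.
  by rewrite mxrank_tr mxrankMfree ?row_base_free // rank_pid_mx.
have /sub_kermxP NA : (row_base N <= kermx A)%MS by rewrite eq_row_base.
by rewrite -trmx_mul -mulmxA NA mulmx0 trmx0.
Qed.

Lemma full_rank_mulmxI (m s p : nat) (U : 'M[K]_(m, s)) (Y : 'M_(s, p)) :
  \rank U = s -> U *m Y = 0 -> Y = 0.
Proof.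
move=> rU UY; have /sub_kermxP : Y^T *m U^T = 0 by rewrite -trmx_mul UY trmx0.
have -> : kermx U^T = 0 by apply/eqP; rewrite kermx_eq0 /row_free mxrank_tr rU.
by rewrite submx0 => /eqP Y0; rewrite -[Y]trmxK Y0 trmx0.
Qed.

(* Independence of [E] in the bipartite rigidity matroid at the points given by
   the rows of [A] and [B]. *)
Definition rigidity_independent (m n : nat) (E : {set 'I_m * 'I_n})
    (A : 'M[K]_(m, 2)) (B : 'M[K]_(n, 2)) :=
  forall X : 'M[K]_(m, n),
    (forall e, e \notin E -> X e.1 e.2 = 0) -> A^T *m X = 0 -> X *m B = 0 -> X = 0.

Variables (m n : nat) (E : {set 'I_m * 'I_n}).
Hypotheses (hm : (2 <= m)%N) (hn : (2 <= n)%N).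

(** For [A] and [B] dual to [U] and [V], the equations [A^T *m X = 0] and [X *m B = 0] say that [X]
    is a codeword. *)
Lemma no_codeword_rigidity (U : 'M[K]_(m, m - 2)) (V : 'M[K]_(n, n - 2)) :
  \rank U = (m - 2)%N -> \rank V = (n - 2)%N -> no_codeword_in E U V ->
  exists A B, rigidity_independent E A B.
Proof.
move=> rU rV noc.
have [A hA] := left_kernel_basis rU (subnK hm).
have [B hB] := left_kernel_basis rV (subnK hn).
exists A, B => X XE /hA[Y XY] XB; subst X.
have YB : Y *m B = 0 by apply: (full_rank_mulmxI rU); rewrite mulmxA.
have /hB[Z YZ] : B^T *m Y^T = 0 by rewrite -trmx_mul YB trmx0.
have {}YZ : Y = Z^T *m V^T by rewrite -trmx_mul -YZ trmxK.
by subst Y; rewrite (noc Z^T) ?mul0mx ?mulmx0 // => e /XE; rewrite mulmxA.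
Qed.

Lemma rigidity_no_codeword A B : rigidity_independent E A B ->
  exists (U : 'M[K]_(m, m - 2)) (V : 'M[K]_(n, n - 2)), no_codeword_in E U V.
Proof.
move=> rig.
have [U rU AU] := left_kernel_full_rank A (subnK hm).
have [V rV BV] := left_kernel_full_rank B (subnK hn).
exists U, V => Z ZE.
have /rig X0 : forall e, e \notin E -> (U *m Z *m V^T) e.1 e.2 = 0 by [].
have {X0} : U *m Z *m V^T = 0.
  apply: X0; first by rewrite !mulmxA AU !mul0mx.
  by rewrite -!mulmxA -[B]trmxK -trmx_mul BV trmx0 !mulmx0.
rewrite -mulmxA => /(full_rank_mulmxI rU) ZV.
rewrite -[Z]trmxK (full_rank_mulmxI rV (_ : V *m Z^T = 0)) ?trmx0 //.
by rewrite -[V]trmxK -trmx_mul ZV trmx0.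
Qed.

End Orthogonal.

(** * From orientations to independence *)

Section GraphCycles.
Variable V : finType.
Implicit Types g d : rel V.

(* Close up a maximal simple path at its first vertex. *)
Lemma min_degree2_cycle g x0 y0 : symmetric g -> irreflexive g ->
  (forall x y, g x y -> exists2 z, z != y & g x z) -> g x0 y0 ->
  exists c, graph_cycle g c.
Proof.
move=> gsym girr deg2 g0.
have [b] := ubnP (#|V| - 2).
have : uniq [:: x0; y0] by rewrite /= inE andbT; apply/eqP => e; rewrite e girr in g0.
have : path g x0 [:: y0] by rewrite /= g0.
rewrite -[2%N]/(size [:: x0; y0]).
elim: b x0 y0 [::] {g0} => // b IHb x y p pg up; rewrite ltnS => le_b.
have [z zy xz] := deg2 x y (proj1 (andP pg)).
have [zp | zp] := boolP (z \in p).
  case/splitPr: zp pg up {le_b} => p1 p2 pg up.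
  exists [:: x, y & rcons p1 z]; split; first by rewrite /= size_rcons.
  have [pg1 gxy] : path g y (rcons p1 z) /\ g x y.
    by move: pg; rewrite -cat_rcons /= cat_path => /and3P[].
  have u1 : uniq [:: x, y & rcons p1 z].
    by move: up; rewrite -cat_rcons -!cat_cons cat_uniq => /and3P[].
  rewrite /ucycle u1 andbT /= gxy rcons_path pg1 last_rcons.
  by rewrite gsym.
have zx : z != x by apply/eqP => e; rewrite e girr in xz.
have uz : uniq [:: z, x, y & p].
  by rewrite cons_uniq up !inE negb_or zx negb_or zy zp.
apply: (IHb z x (y :: p)) => //; first by rewrite /= gsym xz.
have := uniq_leq_size uz (fun v _ => mem_enum V v); rewrite -cardE /= => leV.
by apply: leq_trans le_b; apply: ltn_sub2l.
Qed.

(** The rank of a vertex is the number of vertices from which it can be reached. *)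
Lemma acyclic_rank g d : orientation g d -> (forall c, ~ directed_cycle g d c) ->
  exists rk : V -> nat, forall x y, d x y -> (rk x < rk y)%N.
Proof.
move=> [gd anti] acy.
exists (fun x => #|[set z | connect d z x]|) => x y dxy.
apply: proper_card; apply/properP; split.
  by apply/subsetP => z; rewrite !inE => /connect_trans; apply; apply: connect1.
exists y; rewrite !inE ?connect0 //; apply/negP => /connectP[p0 pd0 lx].
case/shortenP: pd0 lx => p pd up _ lx.
have cd : cycle d (y :: p) by rewrite /= rcons_path pd -lx.
apply: (acy (y :: p)); split; last by move=> z; apply: next_cycle.
split.
  (* A cycle needs three vertices: shorter closed walks are a loop or an edge directed both ways,
     which [anti] excludes. *)
  case: p lx pd {up cd} => [|z [|t p]] //= lx pd.
    by have := anti x y; rewrite dxy lx -{1}lx dxy.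
  by have := anti x y; rewrite dxy lx; case/andP: pd => ->.
rewrite /ucycle up andbT; apply: sub_cycle cd => a b dab.
by rewrite gd dab.
Qed.

End GraphCycles.

Section BipartiteForest.
Variables (K : fieldType) (m n : nat).
Implicit Types (E G : {set 'I_m * 'I_n}) (d : rel ('I_m + 'I_n)).

Lemma bip_graph_sym E : symmetric (bip_graph E).
Proof. by case=> [i|j] [i'|j']. Qed.

Lemma bip_graph_irr E : irreflexive (bip_graph E).
Proof. by case. Qed.

(** In the support of [y] no vertex has degree one, so a nonempty support would contain a cycle. *)
Lemma forest_no_circulation G (y : 'I_m -> 'I_n -> K) :
  (forall c, ~ graph_cycle (bip_graph G) c) ->
  (forall i j, (i, j) \notin G -> y i j = 0) ->
  (forall i, \sum_j y i j = 0) -> (forall j, \sum_i y i j = 0) ->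
  forall i j, y i j = 0.
Proof.
move=> noc yG rows cols i j; apply/eqP/negPn/negP => nz.
pose S := [set e | y e.1 e.2 != 0].
have SG : subrel (bip_graph S) (bip_graph G).
  have SGe e : e \in S -> e \in G.
    by rewrite inE; apply: contraR => eG; rewrite yG //; case: e eG.
  by move=> [a|b] [a'|b'] //=; apply: SGe.
have other (I : finType) (f : I -> K) a : \sum_b f b = 0 -> f a != 0 ->
    exists2 b, b != a & f b != 0.
  move=> sum0 fa; have [b /andP[ba fb] | nex] := pickP [pred b | (b != a) && (f b != 0)].
    by exists b.
  case/negP: fa; apply/eqP; rewrite -[RHS]sum0 (bigD1 a) //= big1 ?addr0 // => b ba.
  by have := nex b; rewrite /= ba => /negbFE/eqP.
have [||||c [sc cc]] := @min_degree2_cycle _ (bip_graph S) (inl i) (inr j).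
- exact: bip_graph_sym.
- exact: bip_graph_irr.
- move=> [a|b] [a'|b'] //=; rewrite inE /= => nz'.
    by have [b ne] := other _ _ _ (rows a) nz'; exists (inr b); rewrite /= ?inE.
  by have [a ne] := other _ (y^~ b) _ (cols b) nz'; exists (inl a); rewrite /= ?inE.
- by rewrite /= inE.
case/andP: cc => cc uc; apply: (noc c); split=> //.
by rewrite /ucycle uc andbT; apply: sub_cycle cc.
Qed.

(** A cycle changes sides at every step, so edges all directed towards the same side are traversed
    alternately forwards and backwards. *)
Lemma one_way_cycle_alternating E G d c : orientation (bip_graph E) d ->
  G \subset E ->
  (forall i j, (i, j) \in G -> d (inl i) (inr j)) \/
  (forall i j, (i, j) \in G -> d (inr j) (inl i)) ->
  graph_cycle (bip_graph G) c -> alternating_cycle (bip_graph E) d c.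
Proof.
move=> [_ anti] /subsetP GE dir [sc /andP[cc uc]]; split.
  split=> //; rewrite /ucycle uc andbT; apply: sub_cycle cc => x y.
  by case: x y => [i|j] [i'|j'] //=; apply: GE.
move=> x xc; have e1 := next_cycle cc xc.
have e2 : bip_graph G (next c x) (next c (next c x)).
  by apply: next_cycle cc _; rewrite mem_next.
move: (next c x) (next c (next c x)) e1 e2 => y z.
have nd a b : d a b -> d b a = false by move=> dab; have := anti a b; rewrite dab => /negPf.
by case: dir => dir; case: x y z {xc} => [i|j] [i'|j'] [i''|j''] //= /dir e1 /dir e2;
  rewrite ?e1 ?e2 ?(nd _ _ e1) ?(nd _ _ e2).
Qed.

(* Put [gamma_v = t^(rk v)] and rescale [X i j] by [t^min(rk i, rk j)].  At
   [t = 0] the rigidity equations say that at each vertex the weights of the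
   outgoing edges and those of the incoming edges both sum to zero. *)
Lemma orientation_rigidity E d :
  orientation (bip_graph E) d ->
  (forall c, ~ directed_cycle (bip_graph E) d c) ->
  (forall c, ~ alternating_cycle (bip_graph E) d c) ->
  exists A B, @rigidity_independent {fraction {poly K}} m n E A B.
Proof.
move=> ori acy noalt; have [rk rkP] := acyclic_rank ori acy.
pose ri i := rk (inl i); pose rj j := rk (inr j).
pose t : {fraction {poly K}} := tofrac 'X.
have t0 : t != 0 by rewrite tofrac_eq0 polyX_eq0.
exists (\matrix_(i, k) t ^+ (k * ri i)), (\matrix_(j, k) t ^+ (k * rj j)).
pose mn (e : 'I_m * 'I_n) := minn (ri e.1) (rj e.2).
pose inc (v : 'I_m + 'I_n) (e : 'I_m * 'I_n) :=
  match v with inl i => e.1 == i | inr j => e.2 == j end.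
(* For the rescaled unknowns, [inl (b, v)] is the equation at [v] weighted by the rank of the left
   end ([b = true]) or of the right end; [inr f] imposes the support condition. *)
pose q (e : 'I_m * 'I_n) (f : bool * ('I_m + 'I_n) + 'I_m * 'I_n) : {poly K} :=
  match f with
  | inl (b, v) =>
      'X^((if b then ri e.1 else rj e.2) - mn e) *+ inc v e
  | inr f => ((e == f) && (e \notin E))%:R
  end.
pose E1 := [set e in E | d (inl e.1) (inr e.2)].
pose E2 := [set e in E | d (inr e.2) (inl e.1)].
have sumL (T : zmodType) (f : 'I_m * 'I_n -> T) i : \sum_e f e *+ (e.1 == i) = \sum_j f (i, j).
  transitivity (\sum_i' \sum_j f (i', j) *+ (i' == i)).
    by rewrite pair_bigA; apply: eq_bigr => -[].
  rewrite (bigD1 i) //=.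
  rewrite [X in _ + X]big1 ?addr0 => [|i' /negPf ne]; last first.
    by rewrite big1 // => j _; rewrite ne.
  by apply: eq_bigr => j _; rewrite eqxx.
have sumR (T : zmodType) (f : 'I_m * 'I_n -> T) j : \sum_e f e *+ (e.2 == j) = \sum_i f (i, j).
  transitivity (\sum_j' \sum_i f (i, j') *+ (j' == j)).
    by rewrite exchange_big pair_bigA; apply: eq_bigr => -[].
  rewrite (bigD1 j) //=.
  rewrite [X in _ + X]big1 ?addr0 => [|j' /negPf ne]; last first.
    by rewrite big1 // => i _; rewrite ne.
  by apply: eq_bigr => i _; rewrite eqxx.
have psiq : injective_system (fun e f => horner_eval 0 (q e f)).
  move=> y y0.
  have yE e : e \notin E -> y e = 0.
    move=> eE; have := y0 (inr e); rewrite (bigD1 e) //= big1 ?addr0 => [|f ne].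
      by rewrite eqxx eE /horner_eval hornerC mulr1.
    by rewrite (negPf ne) /horner_eval hornerC mulr0.
  (* At [t = 0] only exponent 0 survives: the edges whose end on the side chosen by [b] has the
     smaller rank, that is, those leaving this side. *)
  have key (b : bool) v : \sum_e y e *+ ((if b then ri e.1 <= rj e.2 else rj e.2 <= ri e.1)%N
      && inc v e) = 0.
    rewrite -[RHS](y0 (inl (b, v))); apply: eq_bigr => e _ /=.
    rewrite /horner_eval hornerMn hornerXn expr0n subn_eq0 mulrnAr mulr_natr -mulrnA mulnb.
    congr (_ *+ (_ && _)); by case: (b); rewrite leq_min leqnn ?andbT.
  have inE12 e : e \in E ->
      ((e \in E1) = (ri e.1 <= rj e.2)%N) * ((e \in E2) = (rj e.2 <= ri e.1)%N).
    move=> eE; have [gd anti] := ori.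
    have : bip_graph E (inl e.1) (inr e.2) by rewrite /= -surjective_pairing.
    rewrite !inE eE gd /= => /orP[d1 | d1]; have := rkP _ _ d1; rewrite /ri /rj.
      have := anti (inl e.1) (inr e.2); rewrite d1 /= => /negPf -> lt.
      by rewrite (ltnW lt) leqNgt lt.
    have := anti (inr e.2) (inl e.1); rewrite d1 /= => /negPf -> lt.
    by rewrite (ltnW lt) leqNgt lt.
  have y1 (b : bool) e : y e *+ (e \in if b then E1 else E2) = 0.
    rewrite (surjective_pairing e); move: e.1 e.2 => {e} i j.
    have eqy e : y e *+ (e \in if b then E1 else E2) =
        y e *+ (if b then ri e.1 <= rj e.2 else rj e.2 <= ri e.1)%N.
      have [eE | eE] := boolP (e \in E); last by rewrite yE // !mul0rn.
      by case: (b); rewrite !inE12.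
    apply: (@forest_no_circulation (if b then E1 else E2)
              (fun i j => y (i, j) *+ ((i, j) \in if b then E1 else E2))).
    - move=> c gc; apply: (noalt c).
      case: b gc {eqy} => gc; apply: (one_way_cycle_alternating ori _ _ gc).
      + by apply/subsetP => e; rewrite inE => /andP[].
      + by left=> a a'; rewrite inE => /andP[].
      + by apply/subsetP => e; rewrite inE => /andP[].
      + by right=> a a'; rewrite inE => /andP[].
    - by move=> a a' /negPf ->.
    - move=> a; rewrite -(sumL _ (fun e => y e *+ (e \in if b then E1 else E2))).
      rewrite -[RHS](key b (inl a)); apply: eq_bigr => e _.
      by rewrite eqy -mulrnA mulnb.
    - move=> a; rewrite -(sumR _ (fun e => y e *+ (e \in if b then E1 else E2))).
      rewrite -[RHS](key b (inr a)); apply: eq_bigr => e _.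
      by rewrite eqy -mulrnA mulnb.
  move=> e; have [eE | /yE //] := boolP (e \in E).
  have [le | /ltnW le] := leqP (ri e.1) (rj e.2).
    by have := y1 true e; rewrite inE12 // le.
  by have := y1 false e; rewrite inE12 // le.
have phiq : injective_system (fun e f => tofrac (q e f)).
  apply: injective_system_specialization psiq => a /eqP.
  by rewrite tofrac_eq0 => /eqP ->; rewrite rmorph0.
move=> X XE AX XB; apply/matrixP => i j; rewrite mxE.
(* When [b] selects the side of [v], the power of [t] is common to all edges at [v] and the constant
   column of [A] or [B] is used; otherwise the other column is. *)
have key v (b : bool) : \sum_e X e.1 e.2 * t ^+ (if b then ri e.1 else rj e.2) *+
    inc v e = 0.
  have rowX i' (k : 'I_2) : \sum_j' X i' j' * t ^+ (k * rj j') = 0.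
    have := congr1 (fun M : 'M_(m, 2) => M i' k) XB; rewrite !mxE => s0.
    by rewrite -[RHS]s0; apply: eq_bigr => j' _; rewrite mxE.
  have colX j' (k : 'I_2) : \sum_i' X i' j' * t ^+ (k * ri i') = 0.
    have := congr1 (fun M : 'M_(2, n) => M k j') AX; rewrite !mxE => s0.
    by rewrite -[RHS]s0; apply: eq_bigr => i' _; rewrite !mxE mulrC.
  case: v => [i' | j'] /=.
    rewrite (sumL _ (fun e => X e.1 e.2 * t ^+ (if b then ri e.1 else rj e.2))) /=.
    case: b; last by rewrite -[RHS](rowX i' 1); apply: eq_bigr => j' _; rewrite mul1n.
    rewrite -mulr_suml -[RHS](mul0r (t ^+ ri i')) -[in RHS](rowX i' 0); congr (_ * _).
    by apply: eq_bigr => j' _; rewrite mul0n mulr1.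
  rewrite (sumR _ (fun e => X e.1 e.2 * t ^+ (if b then ri e.1 else rj e.2))) /=.
  case: b; first by rewrite -[RHS](colX j' 1); apply: eq_bigr => i' _; rewrite mul1n.
  rewrite -mulr_suml -[RHS](mul0r (t ^+ rj j')) -[in RHS](colX j' 0); congr (_ * _).
  by apply: eq_bigr => i' _; rewrite mul0n mulr1.
have : X i j * t ^+ mn (i, j) = 0.
  apply: (phiq (fun e => X e.1 e.2 * t ^+ mn e) _ (i, j)) => -[[b v] | f].
    rewrite -[RHS](key v b); apply: eq_bigr => e _.
    rewrite rmorphMn rmorphXn /= -/t mulrnAr -mulrA -exprD subnKC //.
    by case: (b); rewrite ?geq_minl ?geq_minr.
  apply: big1 => e _ /=; have [-> | _] := eqVneq e f; last by rewrite tofrac0 mulr0.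
  have [fE | fE] := boolP (f \in E); first by rewrite tofrac0 mulr0.
  by rewrite XE // !mul0r.
by move/eqP; rewrite mulf_eq0 expf_eq0 (negPf t0) andbF orbF => /eqP.
Qed.

End BipartiteForest.

(** * Algebraic independence and valuations *)

Section AlgebraicIndependence.
Variables (K : fieldType) (N : nat).
Let T := {poly {mpoly K[N]}}.
Let iota : {rmorphism K -> T} := polyC \o @mpolyC N K.

Lemma mmap_rmorph (S S' : comNzRingType) (f : {rmorphism K -> S}) (v : 'I_N -> S)
    (h : {rmorphism S -> S'}) (p : {mpoly K[N]}) :
  h (mmap f v p) = mmap (h \o f) (h \o v) p.
Proof.
rewrite /mmap rmorph_sum; apply: eq_bigr => mon _; rewrite rmorphM; congr (_ * _).
by rewrite /mmap1 rmorph_prod; apply: eq_bigr => i _; rewrite rmorphXn.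
Qed.

(* The lowest-order term in ['X] of [g ('X * (y + 'X * z))] is the lowest
   homogeneous component of [g], evaluated at the indeterminates [y]. *)
Lemma alg_independent_perturbation0 (z : 'I_N -> T) (g : {mpoly K[N]}) :
  mmap iota (fun i => 'X * (('X_i)%:P + 'X * z i)) g = 0 -> g = 0.
Proof.
move=> g0; apply/eqP/negPn/negP => nz.
(* The monomial order refines the degree, so the least monomial of [g] has the least degree; its
   coefficient is read off after division by ['X^d] and evaluation at 0. *)
pose d := mdeg (mlast g).
have dP mon : mon \in msupp g -> (d <= mdeg mon)%N by move/mlast_lemc/lemc_mdeg.
pose w mon := \prod_(i < N) (('X_i)%:P + 'X * z i : T) ^+ (mon : 'X_{1..N}) i.
pose S := \sum_(mon <- msupp g) iota g@_mon * ('X^(mdeg mon - d) * w mon).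
have S0 : S = 0.
  apply: (@mulfI _ ('X^d : T)); first by rewrite expf_neq0 // polyX_eq0.
  rewrite mulr0 -[RHS]g0 /mmap /S mulr_sumr big_seq [RHS]big_seq.
  apply: eq_bigr => mon /dP le_d; rewrite mulrCA; congr (_ * _).
  rewrite mulrA -exprD subnKC // /mmap1 (eq_bigr _ (fun i _ => exprMn _ _ _)) big_split /=.
  by rewrite prodrXr mdegE.
have := congr1 (fun p : T => mcoeff (mlast g) p.[0]) S0.
rewrite horner0 mcoeff0 /S horner_sum raddf_sum (bigD1_seq (mlast g)) /=; last first.
- exact: msupp_uniq.
- by rewrite mlast_supp.
have wE mon : (w mon).[0] = 'X_[mon].
  rewrite /w horner_prod [RHS]mpolyXE_id; apply: eq_bigr => i _.
  by rewrite horner_exp !hornerE.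
rewrite big1 ?addr0 => [|mon ne].
  rewrite subnn expr0 mul1r hornerM wE /= hornerC mcoeffCM mcoeffX eqxx mulr1.
  by move/eqP; rewrite mcoeff_eq0 mlast_supp.
rewrite !hornerM wE /= hornerC hornerXn mcoeffCM expr0n.
by case: eqP => _; rewrite ?mul1r ?mul0r ?mcoeff0 ?mcoeffX ?(negPf ne) mulr0.
Qed.

(** The invertible translation by [c] reduces this to points near the origin. *)
Lemma alg_independent_perturbation (c : 'I_N -> K) (z : 'I_N -> T) (f : {mpoly K[N]}) :
  mmap iota (fun i => iota (c i) + 'X * (('X_i)%:P + 'X * z i)) f = 0 -> f = 0.
Proof.
move=> f0; pose g := mmap (@mpolyC N K) (fun i => 'X_i + (c i)%:MP) f.
have g0 : g = 0.
  apply: (@alg_independent_perturbation0 z); rewrite -[RHS]f0.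
  rewrite /g (mmap_rmorph _ _ (mmap iota _)); apply: eq_bigr => mon _.
  congr (_ * _); first by rewrite /= mmapC.
  by apply: eq_bigr => i _; rewrite /= rmorphD /= mmapX mmap1U mmapC addrC.
have <- : mmap (@mpolyC N K) (fun i => 'X_i - (c i)%:MP) g = f.
  rewrite /g (mmap_rmorph _ _ (mmap (@mpolyC N K) _)).
  transitivity (mmap (@mpolyC N K) (fun i => 'X_i) f).
    apply: eq_bigr => mon _; congr (_ * _); first by rewrite /= mmapC.
    by apply: eq_bigr => i _; rewrite /= rmorphD /= mmapX mmap1U mmapC subrK.
  rewrite [RHS]mpolyE; apply: eq_bigr => mon _.
  by rewrite mmap1_id mul_mpolyC.
by rewrite g0 rmorph0.
Qed.

End AlgebraicIndependence.

(** * Chevalley's extension theorem *)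

Section Chevalley.
Variable F : fieldType.
Implicit Types (A I : F -> Prop) (x y : F).

Definition zmod_pred A := A 0 /\ forall x y, A x -> A y -> A (x - y).

Definition subring_pred A := [/\ A 1, zmod_pred A & forall x y, A x -> A y -> A (x * y)].

Definition proper_ideal A I :=
  [/\ zmod_pred I, forall a x, A a -> I x -> I (a * x) & ~ I 1].

(** Applied to a ring [A] this is [A[x]]; applied to an ideal [I] of [A] it is the ideal generated
    by [I] in [A[x]]. *)
Definition adjoin A x y := exists2 P : {poly F}, forall i, A P`_i & y = P.[x].

Lemma zmod_predD A x y : zmod_pred A -> A x -> A y -> A (x + y).
Proof.
by move=> [A0 AB] Ax Ay; rewrite -[y]opprK; apply: (AB) => //; rewrite -sub0r; apply: AB.
Qed.

Lemma zmod_pred_sum A (J : Type) (r : seq J) (P : pred J) (f : J -> F) :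
  zmod_pred A -> (forall j, P j -> A (f j)) -> A (\sum_(j <- r | P j) f j).
Proof.
by move=> zA Af; apply: (big_ind A) => //; [case: zA | move=> ? ?; apply: zmod_predD].
Qed.

Lemma adjoin_sub A x y : zmod_pred A -> A y -> adjoin A x y.
Proof.
move=> [A0 _] Ay; exists y%:P; last by rewrite hornerC.
by move=> i; rewrite coefC; case: eqP.
Qed.

Lemma adjoin_gen A x : subring_pred A -> adjoin A x x.
Proof.
move=> [A1 [A0 _] _]; exists 'X; last by rewrite hornerX.
by move=> i; rewrite coefX; case: eqP.
Qed.

Lemma adjoin_zmod A x : zmod_pred A -> zmod_pred (adjoin A x).
Proof.
move=> zA; split; first by apply: adjoin_sub => //; case: zA.
move=> _ _ [P AP ->] [Q AQ ->]; exists (P - Q); last by rewrite hornerD hornerN.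
by move=> i; rewrite coefB; apply: (proj2 zA).
Qed.

Lemma adjoinM A B C x y z : zmod_pred C -> (forall a b, A a -> B b -> C (a * b)) ->
  adjoin A x y -> adjoin B x z -> adjoin C x (y * z).
Proof.
move=> zC ABC [P AP ->] [Q AQ ->]; exists (P * Q); last by rewrite hornerM.
by move=> i; rewrite coefM; apply: zmod_pred_sum => // j _; apply: ABC.
Qed.

(** Infinite descent on the lengths of two relations [1 = P(x) = Q(1/x)]: the second one serves to
    lower the degree of the longer one. *)
Lemma adjoin_or_inv A I x : subring_pred A -> (forall y, I y -> A y) -> proper_ideal A I ->
  x != 0 -> ~ (adjoin I x 1 /\ adjoin I x^-1 1).
Proof.
move=> [A1 zA AM] IA [zI IM I1] x0 [[P IP P1] [Q IQ Q1]].
have [k] := ubnP (size P + size Q).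
elim: k x x0 P IP P1 Q IQ Q1 => // k IHk.
have wlog_size x (P Q : {poly F}) : x != 0 -> (forall i, I P`_i) -> 1 = P.[x] ->
    (forall i, I Q`_i) -> 1 = Q.[x^-1] -> (size Q <= size P)%N ->
    (size P + size Q < k.+1)%N -> False.
  move=> x0 IP P1 IQ Q1 leQP; rewrite ltnS => le_k.
  case n0 : (size P) leQP le_k => [|n] leQP le_k.
    move/eqP: n0; rewrite size_poly_eq0 => /eqP P0; move/eqP: P1.
    by rewrite P0 horner0 oner_eq0.
  have [n_eq0 | n_gt0] := posnP n.
    have PE : P = (P`_0)%:P by apply: size1_polyC; rewrite n0 n_eq0.
    by apply: I1; rewrite P1 PE hornerC.
  (* [n] is the degree of [P], and [R] is [Q] without its constant term [q_0], reversed, so that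
     [R(x) = (1 - q_0) x^n]. Multiplying [P] by [1 - q_0] and replacing its top term by means of [R]
     gives [P'], again of value 1 once [q_0] is added. *)
  pose R := \poly_(i < n) Q`_(n - i).
  have Rx : R.[x] = (1 - Q`_0) * x ^+ n.
    rewrite horner_poly; apply: (@addrI _ (Q`_0 * x ^+ n)).
    rewrite -mulrDl [X in _ = X * _]addrC subrK [X in _ = X * _]Q1 (horner_coef_wide _ leQP).
    rewrite mulr_suml big_ord_recl mulr1; congr (_ + _).
    rewrite (reindex_inj rev_ord_inj) /=; apply: eq_bigr => i _.
    rewrite subKn // /bump add1n -mulrA; congr (_ * _).
    by rewrite exprVn -[n in x ^+ n](subnK (ltn_ord i)) exprD mulrC mulrK // unitfE expf_neq0.
  have I0 : I 0 by case: zI.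
  pose P' := (Q`_0)%:P + (1 - Q`_0) *: (P - P`_n *: 'X^n) + P`_n *: R.
  apply: (IHk x x0 P' _ _ Q IQ Q1).
  - move=> i; rewrite !coefD coefC !coefZ coefB coefZ coefXn coef_poly.
    have AIc y z : A y -> I z -> I (y * z) by apply: IM.
    apply: zmod_predD => //; first apply: zmod_predD => //.
    + by case: eqP.
    + apply: IM; first by apply: (proj2 zA) => //; apply: IA.
      by apply: (proj2 zI) => //; case: eqP => _; rewrite ?mulr1 ?mulr0.
    + by apply: IM; [apply: IA | case: ifP].
  - rewrite /P' !hornerE -P1 Rx.
    by ring.
  - rewrite (leq_trans _ le_k) // ltn_add2r ltnS.
    apply/leq_sizeP => j le_nj.
    rewrite !coefD coefC !coefZ coefB coefZ coefXn coef_poly ltnNge le_nj.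
    rewrite mulr0 addr0 (gtn_eqF (leq_trans n_gt0 le_nj)) add0r.
    have [-> | ne] := eqVneq j n; first by rewrite mulr1 subrr mulr0.
    by rewrite mulr0 subr0 [P`_j]nth_default ?mulr0 // n0 ltn_neqAle eq_sym ne.
move=> x x0 P IP P1 Q IQ Q1 lt_k.
have [le | /ltnW le] := leqP (size Q) (size P); first exact: (wlog_size x P Q).
by apply: (wlog_size x^-1 Q P); rewrite ?invr_eq0 ?invrK 1?addnC.
Qed.

Lemma adjoin_subring A x : subring_pred A -> subring_pred (adjoin A x).
Proof.
move=> [A1 zA AM]; split; [exact: adjoin_sub | exact: adjoin_zmod |].
by move=> y z; apply: adjoinM.
Qed.

Lemma adjoin_ideal A I x : proper_ideal A I -> ~ adjoin I x 1 ->
  proper_ideal (adjoin A x) (adjoin I x).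
Proof.
by move=> [zI IM _] I1; split=> //; [exact: adjoin_zmod | move=> y z; apply: adjoinM].
Qed.

(* Chevalley's extension theorem for finitely many elements. *)
Lemma valuation_extension A I (s : seq F) :
  subring_pred A -> (forall y, I y -> A y) -> proper_ideal A I -> 0 \notin s ->
  exists A' I', [/\ subring_pred A', proper_ideal A' I', forall y, A y -> A' y,
    forall y, I y -> I' y & forall x, x \in s -> A' x \/ A' x^-1].
Proof.
elim: s A I => [|x s IHs] A I sA IA pI; first by exists A, I; split.
rewrite inE negb_or eq_sym => /andP[x0 s0].
have ext y : ~ adjoin I y 1 -> y \in [:: x; x^-1] -> exists A' I',
    [/\ subring_pred A', proper_ideal A' I', forall y, A y -> A' y,
    forall y, I y -> I' y & forall z, z \in x :: s -> A' z \/ A' z^-1].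
  move=> I1 yx; have [|A' [I' [sA' pI' AA' II' sA's]]] :=
      IHs (adjoin A y) (adjoin I y) (adjoin_subring _ sA) _ (adjoin_ideal pI I1) s0.
    by move=> z [P IP ->]; exists P => // i; apply: IA.
  have A'y : A' y by apply/AA'/adjoin_gen.
  exists A', I'; split=> // [z Az | z Iz | z].
  - by apply/AA'/adjoin_sub => //; case: sA.
  - by apply/II'/adjoin_sub => //; case: pI.
  - rewrite inE => /orP[/eqP-> | /sA's //].
    by move: yx A'y; rewrite !inE => /orP[] /eqP->; [left | right].
have [I1 | I1] := classic (adjoin I x 1); last by apply: (ext x); rewrite ?inE ?eqxx.
apply: (ext x^-1); last by rewrite !inE eqxx orbT.
by move=> I2; apply: (adjoin_or_inv sA IA pI x0).
Qed.

End Chevalley.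

(** * Valuations separating monomials *)

Section SeparatingRing.
Variables (K F : fieldType) (iota : {rmorphism K -> F}) (N : nat) (M : 'I_N -> F).
Hypothesis ind : forall f : {mpoly K[N]}, mmap iota M f = 0 -> f = 0.
Implicit Types (r : rel 'X_{1..N}) (y z : F).

Let mon (a : 'X_{1..N}) := mmap1 M a.

Let mon_neq0 a : mon a != 0.
Proof.
apply/eqP => a0; have /ind : mmap iota M 'X_[a] = 0 by rewrite mmapX.
by move/(congr1 (mcoeff a)); rewrite mcoeffX eqxx mcoeff0; apply/eqP; rewrite oner_eq0.
Qed.

Let mmap1D a b : mmap1 M (a + b)%MM = mmap1 M a * mmap1 M b.
Proof. by apply: commr_mmap1_M => i x; apply: mulrC. Qed.

(* [dominated <=%O] and [dominated <%O] are the ring of elements of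
   nonnegative value and the ideal of elements of positive value for the
   monomial order, within Laurent polynomials in the [M i]. *)
Definition dominated r y :=
  exists f b, (forall a, a \in msupp f -> r b a) /\ y * mmap1 M b = mmap iota M f.

Lemma dominatedM r1 r2 r3 y z :
  (forall b1 a1 b2 a2, r1 b1 a1 -> r2 b2 a2 -> r3 (b1 + b2)%MM (a1 + a2)%MM) ->
  dominated r1 y -> dominated r2 z -> dominated r3 (y * z).
Proof.
move=> r123 [f [b [rf yf]]] [g [c [rg zg]]]; exists (f * g), (b + c)%MM; split.
  by move=> a /msuppM_le/allpairsP[[a1 a2] [/rf a1P /rg a2P ->]]; apply: r123.
by rewrite rmorphM /= -yf -zg mmap1D mulrACA.
Qed.

Lemma dominated_zmod r :
  (forall b a c, r b a -> r (b + c)%MM (a + c)%MM) -> zmod_pred (dominated r).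
Proof.
move=> rD; split=> [|y z [f [b [rf yf]]] [g [c [rg zg]]]].
  by exists 0, 0%MM; rewrite msupp0 mul0r rmorph0; split.
exists (f * 'X_[c] - g * 'X_[b]), (b + c)%MM; split.
  move=> a /msuppB_le; rewrite mem_cat => /orP[] /msuppM_le/allpairsP[[a1 a2] [/= a1f]].
    by rewrite msuppX inE => /eqP -> ->; apply/rD/rf.
  by rewrite msuppX inE => /eqP -> ->; rewrite (addmC b); apply/rD/rg.
by rewrite rmorphB !rmorphM /= !mmapX -yf -zg mmap1D; rewrite /mon; ring.
Qed.

(** The monomial order gives a ring and an ideal to which Chevalley's theorem applies. The quotient
    of a monomial by a smaller one lies in the ideal, so its inverse cannot lie in [A]. *)
Lemma separating_ring (s : seq F) : 0 \notin s -> exists A,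
  [/\ subring_pred A, forall x, x \in s -> A x \/ A x^-1 &
      forall a b z z', a != b -> A z -> A z' ->
        mmap1 M a = z * mmap1 M b -> mmap1 M b = z' * mmap1 M a -> False].
Proof.
move=> s0.
pose r1 : rel 'X_{1..N} := fun b a => (b <= a)%O.
pose r2 : rel 'X_{1..N} := fun b a => (b < a)%O.
have sA : subring_pred (dominated r1).
  split; first by exists 1, 0%MM; rewrite mul1r rmorph1 mmap11; split=> // a; rewrite /r1 le0x.
    by apply: dominated_zmod => b a c; rewrite /r1 lemc_add2l.
  by move=> y z; apply: dominatedM => b1 a1 b2 a2; apply: lem_add.
have IA y : dominated r2 y -> dominated r1 y.
  by move=> [f [b [rf yf]]]; exists f, b; split=> // a /rf; apply: ltW.
have pI : proper_ideal (dominated r1) (dominated r2).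
  split; first by apply: dominated_zmod => b a c; rewrite /r2 ltmc_add2l.
    by move=> y z; apply: dominatedM => b1 a1 b2 a2; apply: lemc_lt_add.
  move=> [f [b [rf]]]; rewrite mul1r => bf.
  (* If 1 were in the ideal, independence would give [f = 'X_[b]], whereas the support of [f] lies
     strictly above [b]. *)
  have /ind/eqP : mmap iota M (f - 'X_[b]) = 0 by rewrite rmorphB /= mmapX -bf subrr.
  rewrite subr_eq0 => /eqP fb; have := rf b; rewrite fb msuppX inE eqxx.
  by move=> /(_ isT); rewrite /r2 ltxx.
have [A [I [sA' [_ IM I1] _ II' As]]] := valuation_extension sA IA pI s0.
exists A; split=> // a b z z'.
have wlog_lt a1 b1 y y' : (b1 < a1)%O -> A y' -> mon a1 = y * mon b1 ->
    mon b1 = y' * mon a1 -> False.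
  move=> lt Ay' e e'; apply: I1; have -> : 1 = y' * y.
    apply: (mulIf (mon_neq0 b1)); by rewrite mul1r {1}e' e mulrA.
  apply: IM => //; apply: II'; exists 'X_[a1], b1; rewrite mmapX; split=> //.
  by move=> a2; rewrite msuppX inE => /eqP ->.
case: ltgtP => // lt _ Az Az' e e'; first exact: (wlog_lt b a z' z).
exact: (wlog_lt a b z z').
Qed.

End SeparatingRing.

(** * Binary trees and linear orders *)

Section BinaryTrees.
Variable V : eqType.

Inductive btree := Leaf of V | Node of btree & btree.

Fixpoint leaves t := match t with Leaf v => [:: v] | Node l r => leaves l ++ leaves r end.

(** The successor makes the total weight of a spine drop when a node is split into its two
    subtrees. *)
Fixpoint weight t := match t with Leaf _ => 1%N | Node l r => (weight l + weight r).+1 end.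

Implicit Types (c : V -> V -> int) (s : seq V) (t : btree) (ts : seq btree).

Definition cross c s1 s2 := \sum_(u <- s1) \sum_(v <- s2) c u v.

Definition forest_leaves ts := flatten (map leaves ts).

Lemma forest_leaves_Leaf s : forest_leaves (map Leaf s) = s.
Proof. by rewrite /forest_leaves; elim: s => //= v s ->. Qed.

Fixpoint balanced c t := match t with
  | Leaf _ => True
  | Node l r => [/\ cross c (leaves l) (leaves r) = 0, balanced c l & balanced c r]
  end.

(* [ts] stands for the rooted binary tree
   [Node t1 (Node t2 (... (Node tk root)))] with a spine of hanging subtrees. *)
Fixpoint spine_balanced c ts := match ts with
  | [::] => True
  | t :: ts' =>
      [/\ cross c (leaves t) (forest_leaves ts') = 0, balanced c t & spine_balanced c ts']
  end.

Definition lin_comb (a b : int) c1 c2 u v := a * c1 u v + b * c2 u v.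

Lemma cross_lin a b c1 c2 s1 s2 :
  cross (lin_comb a b c1 c2) s1 s2 = a * cross c1 s1 s2 + b * cross c2 s1 s2.
Proof.
rewrite /cross !mulr_sumr -big_split; apply: eq_bigr => u _ /=.
by rewrite !mulr_sumr -big_split.
Qed.

Lemma balanced_lin a b c1 c2 t :
  balanced c1 t -> balanced c2 t -> balanced (lin_comb a b c1 c2) t.
Proof.
elim: t => //= l IHl r IHr [x1 l1 r1] [x2 l2 r2]; split; [|exact: IHl|exact: IHr].
by rewrite cross_lin x1 x2 !mulr0 addr0.
Qed.

Lemma spine_balanced_lin a b c1 c2 ts :
  spine_balanced c1 ts -> spine_balanced c2 ts ->
  spine_balanced (lin_comb a b c1 c2) ts.
Proof.
elim: ts => //= t ts IHts [x1 b1 s1] [x2 b2 s2]; split; [|exact: balanced_lin|exact: IHts].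
by rewrite cross_lin x1 x2 !mulr0 addr0.
Qed.

Lemma cross_catl c s1 s2 s : cross c (s1 ++ s2) s = cross c s1 s + cross c s2 s.
Proof. by rewrite /cross big_cat. Qed.

Lemma cross_catr c s s1 s2 : cross c s (s1 ++ s2) = cross c s s1 + cross c s s2.
Proof. by rewrite /cross -big_split; apply: eq_bigr => u _; rewrite big_cat. Qed.

Lemma cross_sym c s1 s2 : (forall u v, c u v = c v u) -> cross c s1 s2 = cross c s2 s1.
Proof.
move=> csym; rewrite /cross exchange_big; apply: eq_bigr => u _.
by apply: eq_bigr => v _.
Qed.

Lemma cross_permr c s s1 s2 : perm_eq s1 s2 -> cross c s s1 = cross c s s2.
Proof. by move=> eqs; apply: eq_bigr => u _; apply: perm_big. Qed.

Section Caterpillar.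
Implicit Type W : (V -> V -> int) -> Prop.

Definition weight_module W :=
  (forall c, W c -> forall u v, c u v = c v u) /\
  (forall a b c1 c2, W c1 -> W c2 -> W (lin_comb a b c1 c2)).

Definition spine_independent W ts :=
  forall c, W c -> spine_balanced c ts -> forall u v, c u v = 0.

Lemma not_spine_independent W ts : ~ spine_independent W ts ->
  exists c, [/\ W c, spine_balanced c ts & ~ forall u v, c u v = 0].
Proof.
move=> /not_all_ex_not[c] nc; exists c.
by split; apply: NNPP => h; apply: nc => Wc bc; [case: h | case: h | apply: NNPP].
Qed.

(* The values of [cross] on the pairs (l, r), (l, ts), (r, ts) are (0, x, -x)
   for the given tree and (x, -x, 0), (x, 0, -x) for the two other trees, so
   nonzero weights on both of these combine to one on the given tree. *)
Lemma spine_independent_rotation W l r ts : weight_module W ->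
  spine_independent W (Node l r :: ts) ->
  spine_independent W [:: l, r & ts] \/ spine_independent W [:: r, l & ts].
Proof.
move=> [Wsym Wlin] ind.
have [ind1 | /not_spine_independent[c1 [W1 /= [x1 l1 [z1 r1 t1]] n1]]] :=
  classic (spine_independent W [:: l, r & ts]); first by left.
have [ind1 | /not_spine_independent[c2 [W2 /= [x2 r2 [y2 l2 t2]] n2]]] :=
  classic (spine_independent W [:: r, l & ts]); first by right.
exfalso; move: x1 x2; rewrite /forest_leaves /= !cross_catr -/(forest_leaves ts).
rewrite (cross_sym _ _ (Wsym _ W2)) => /eqP; rewrite addr_eq0 => /eqP xy1.
move=> /eqP; rewrite addr_eq0 => /eqP xz2.
set p := cross c1 (leaves l) (leaves r) in xy1.
set q := cross c2 (leaves l) (leaves r) in xz2.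
have p0 : p != 0.
  apply/eqP => p0; apply: n1; apply: ind => //=; split=> //.
  by rewrite cross_catl z1 addr0 -[LHS]opprK -xy1 p0 oppr0.
have q0 : q != 0.
  apply/eqP => q0; apply: n2; apply: ind => //=; split=> //.
  by rewrite cross_catl y2 add0r -[LHS]opprK -xz2 q0 oppr0.
have c0 : forall u v, lin_comb q (- p) c1 c2 u v = 0.
  apply: ind; first exact: Wlin.
  split; first 1 last.
  - split; [|exact: balanced_lin|exact: balanced_lin].
    by rewrite cross_lin -/p -/q mulNr mulrC subrr.
  - exact: spine_balanced_lin.
  rewrite /= cross_lin !cross_catl z1 y2 addr0 add0r.
  rewrite -[cross c1 _ _]opprK -xy1 -[cross c2 _ _]opprK -xz2.
  by rewrite mulrNN mulrN mulrC addNr.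
have : cross (lin_comb q (- p) c1 c2) (leaves l) (forest_leaves ts) = 0.
  by rewrite /cross big1 // => u _; rewrite big1 // => v _; rewrite c0.
rewrite cross_lin y2 mulr0 addr0 -[cross c1 _ _]opprK -xy1 => /eqP.
by rewrite mulrN oppr_eq0 mulf_eq0 (negPf p0) (negPf q0).
Qed.

(** Induction on the total weight: a leaf at the head is removed, its condition being added to the
    module [W]; a node at the head is split by a rotation. *)
Lemma caterpillar W ts : weight_module W -> spine_independent W ts ->
  exists2 s, perm_eq s (forest_leaves ts) & spine_independent W (map Leaf s).
Proof.
have [k] := ubnP (sumn (map weight ts)).
elim: k W ts => // k IHk W [|[v | l r] ts] /=; first by exists [::].
- rewrite add1n ltnS => lt_k [Wsym Wlin] ind.
  pose W' c := W c /\ cross c [:: v] (forest_leaves ts) = 0.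
  have [||s eqs ind'] := IHk W' ts lt_k.
  + split=> [c [Wc _] | a b c1 c2 [W1 x1] [W2 x2]]; first exact: Wsym.
    by split; [apply: Wlin | rewrite cross_lin x1 x2 !mulr0 addr0].
  + by move=> c [Wc xc] bc; apply: ind.
  exists (v :: s); first by rewrite /forest_leaves /= perm_cons.
  move=> c Wc /= [xc _ bc]; apply: ind' => //; split=> //.
  rewrite -[RHS]xc; apply: cross_permr; rewrite perm_sym.
  by rewrite forest_leaves_Leaf.
- rewrite addSn ltnS => lt_k mW /(spine_independent_rotation mW) [] ind.
  + have [|s eqs ind'] := IHk W _ _ mW ind; first by rewrite /= addnA.
    by exists s => //; rewrite /forest_leaves /= -catA.
  + have [|s eqs ind'] := IHk W _ _ mW ind; first by rewrite /= addnCA addnA.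
    exists s => //; rewrite /forest_leaves /= -catA; apply: (perm_trans eqs).
    by rewrite /forest_leaves /= perm_catCA.
Qed.

(** In a caterpillar, the node above a leaf separates it from all later leaves. *)
Lemma spine_balanced_order c s : uniq s ->
  (forall v, v \in s -> \sum_(u <- s | (index v s < index u s)%N) c v u = 0) ->
  spine_balanced c (map Leaf s).
Proof.
elim: s => //= v s IHs /andP[vs us] sum0.
have ne u : u \in s -> (v == u) = false by move=> su; apply: contraNF vs => /eqP ->.
split=> //.
  rewrite forest_leaves_Leaf /cross big_seq1 -[RHS](sum0 v (mem_head _ _)) big_cons eqxx ltnn.
  rewrite big_seq [RHS]big_seq_cond; apply: eq_bigl => u.
  by case: (boolP (u \in s)) => // /ne ->.
apply: IHs => // w ws; rewrite -[RHS](sum0 w); last by rewrite inE ws orbT.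
rewrite big_cons eqxx ltn0 (ne w ws) big_seq_cond [RHS]big_seq_cond.
by apply: eq_bigl => u; case: (boolP (u \in s)) => // /ne ->.
Qed.

End Caterpillar.
End BinaryTrees.

(** * Orientations given by linear orders *)

Section OrderOrientation.
Variables (m n : nat) (E : {set 'I_m * 'I_n}).
Let V : finType := ('I_m + 'I_n)%type.
Implicit Types (w : V -> V -> int) (s : seq V).

Definition circulation w :=
  [/\ forall u v, w u v = w v u, forall u v, ~~ bip_graph E u v -> w u v = 0 &
      forall u, \sum_v w u v = 0].

Lemma weight_module_circulation : weight_module circulation.
Proof.
split=> [w [] // | a b w1 w2 [sym1 E1 sum1] [sym2 E2 sum2]]; rewrite /lin_comb.
split=> [u v | u v uv | u]; first by rewrite sym1 sym2.
  by rewrite E1 // E2 // !mulr0.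
by rewrite big_split -!mulr_sumr /= sum1 sum2 !mulr0.
Qed.

Lemma next_next_neq (T : eqType) (c : seq T) x :
  uniq c -> (2 < size c)%N -> x \in c -> next c (next c x) != x.
Proof.
move=> uc sc xc; have [i p cE] := rot_to xc.
have := sc; have := uc; rewrite -(rot_uniq i) -(size_rot i c) -!(next_rot i uc) cE.
case: p {cE} => [|y [|z p]] //=; rewrite !inE !negb_or eqxx.
case/andP=> /and3P[xy xz _] _ _.
by rewrite [y == x]eq_sym (negPf xy) eqxx eq_sym.
Qed.

Let side (u : V) : int := if u is inl _ then 1 else -1.

(* The weight of a cycle in the bipartite graph: [1] on the edges traversed from
   left to right and [-1] on the others. *)
Definition cycle_weight (c : seq V) u v : int :=
  side u * (((u \in c) && (next c u == v))%:R - ((v \in c) && (next c v == u))%:R).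

Lemma cycle_weight_sum c u (P : pred V) : uniq c -> u \in c ->
  \sum_(v | P v) cycle_weight c u v = side u * ((P (next c u))%:R - (P (prev c u))%:R).
Proof.
move=> uc uc'; rewrite -mulr_sumr; congr (_ * _); rewrite sumrB.
have pick x : \sum_(v | P v) (x == v)%:R = (P x)%:R :> int.
  rewrite big_mkcond (bigD1 x) //= eqxx big1 ?addr0; first by case: (P x).
  by move=> v /negPf ne; rewrite eq_sym ne; case: (P v).
rewrite -!pick; congr (_ - _); apply: eq_bigr => v _; first by rewrite uc'.
congr (nat_of_bool _)%:R; apply/andP/eqP => [[vc /eqP <-] | <-].
  by rewrite prev_next.
by rewrite mem_prev uc' next_prev.
Qed.

Lemma circulation_cycle_weight c : graph_cycle (bip_graph E) c ->
  circulation (cycle_weight c).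
Proof.
move=> [sc /andP[cc uc]].
have cE u v : ~~ bip_graph E u v ->
    ((u \in c) && (next c u == v) = false) * ((v \in c) && (next c v == u) = false).
  move=> nE; split; apply: contraNF nE => /andP[xc /eqP <-].
    exact: next_cycle.
  by rewrite bip_graph_sym; apply: next_cycle.
split=> [u v | u v /cE[e1 e2] | u].
- have [uv | /cE[e1 e2]] := boolP (bip_graph E u v); last first.
    by rewrite /cycle_weight e1 e2 subrr !mulr0.
  rewrite /cycle_weight -[in RHS]opprB mulrN -mulNr; congr (_ * _).
  by case: u v uv => [i|j] [i'|j'] //=; rewrite ?opprK.
- by rewrite /cycle_weight e1 e2 subrr mulr0.
- have [uc' | uc'] := boolP (u \in c).
    by rewrite cycle_weight_sum // subrr mulr0.
  rewrite big1 // => v _; rewrite /cycle_weight (negPf uc') /=.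
  suff -> : (v \in c) && (next c v == u) = false by rewrite subrr mulr0.
  by apply: contraNF uc' => /andP[vc /eqP <-]; rewrite mem_next.
Qed.

(** Edges point upwards in the order [s]. On an alternating cycle the two neighbours of a vertex are
    both later or both earlier, so the weight of the cycle would be a nonzero balanced
    circulation. *)
Lemma order_orientation s : perm_eq s (enum V) ->
  spine_independent circulation (map (@Leaf V) s) ->
  exists d : rel V,
    [/\ orientation (bip_graph E) d,
        forall c, ~ directed_cycle (bip_graph E) d c &
        forall c, ~ alternating_cycle (bip_graph E) d c].
Proof.
move=> eqs ind; pose rk x := index x s.
have sV x : x \in s by rewrite (perm_mem eqs) mem_enum.
have us : uniq s by rewrite (perm_uniq eqs) enum_uniq.
have rk_neq x y : bip_graph E x y -> (rk y < rk x)%N = ~~ (rk x < rk y)%N.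
  move=> xy; rewrite ltn_neqAle -leqNgt; case: eqP => // /(index_inj x) => e.
  by move: xy; rewrite e ?bip_graph_irr.
exists (fun x y => bip_graph E x y && (rk x < rk y)%N); split.
- split=> x y; last by apply/negP => /andP[/andP[_ lt1] /andP[_ lt2]];
    have := ltn_trans lt1 lt2; rewrite ltnn.
  rewrite (bip_graph_sym E y); have [xy | //] := boolP (bip_graph E x y).
  by rewrite /= (rk_neq _ _ xy) orbN.
- move=> c [[sc _] dc].
  have [x0 x0c] : exists x0, x0 \in c.
    by case: c sc {dc} => // x0 c _; exists x0; apply: mem_head.
  have [x xc xmax] := arg_maxnP rk x0c.
  have /andP[_] := dc x xc.
  have nxc : next c x \in c by rewrite mem_next.
  by rewrite ltnNge => /negP; apply; apply: xmax nxc.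
- move=> c [gc alt]; have [sc /andP[cc uc]] := gc.
  have w0 : forall u v, cycle_weight c u v = 0.
    apply: ind; first exact: circulation_cycle_weight.
    apply: spine_balanced_order => // v _.
    rewrite (perm_big _ eqs) big_enum_cond /=.
    have [vc | vc] := boolP (v \in c); last first.
      apply: big1 => u _; rewrite /cycle_weight (negPf vc) /=.
      suff -> : (u \in c) && (next c u == v) = false by rewrite subrr mulr0.
      by apply: contraNF vc => /andP[uc' /eqP <-]; rewrite mem_next.
    rewrite cycle_weight_sum //.
    have pc : prev c v \in c by rewrite mem_prev.
    have := alt _ pc; rewrite next_prev //.
    have e1 : bip_graph E (prev c v) v by rewrite -{2}(next_prev uc v); apply: next_cycle.
    rewrite e1 (next_cycle cc vc) /= -/(rk v) -/(rk _) -/(rk (next c v)) (rk_neq _ _ e1).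
    by case: (_ < _)%N; case: (_ < _)%N => //; rewrite subrr mulr0.
  have [x xc] : exists x, x \in c.
    by case: (c) sc => // x c' _; exists x; apply: mem_head.
  (* With at least three vertices, the two terms of [cycle_weight] cannot cancel on an edge of the
     cycle. *)
  have := w0 x (next c x); rewrite /cycle_weight xc eqxx mem_next xc /=.
  rewrite (negPf (next_next_neq uc sc xc)) subr0 mulr1.
  by case: x {xc}.
Qed.

End OrderOrientation.

(** * Ultrametrics *)

Lemma classic_partition (T : eqType) (P : T -> Prop) (s : seq T) : exists s1 s2,
  [/\ perm_eq (s1 ++ s2) s, forall x, x \in s1 -> P x & forall x, x \in s2 -> ~ P x].
Proof.
elim: s => [|x s [s1 [s2 [eqs P1 P2]]]]; first by exists [::], [::].
have [Px | nPx] := classic (P x).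
  exists (x :: s1), s2; split=> //=; first by rewrite perm_cons.
  by move=> y; rewrite inE => /orP[/eqP-> | /P1].
exists s1, (x :: s2); split=> //.
  by rewrite (perm_trans (permEl (perm_catCA s1 [:: x] s2))) //= perm_cons.
by move=> y; rewrite inE => /orP[/eqP-> | /P2].
Qed.

Lemma preorder_max (T : eqType) (R : T -> T -> Prop) (s : seq T) x0 :
  (forall x y, R x y \/ R y x) -> (forall y x z, R x y -> R y z -> R x z) -> x0 \in s ->
  exists2 x, x \in s & forall y, y \in s -> R y x.
Proof.
move=> tot trans; have refl x : R x x by case: (tot x x).
elim: s x0 => // x [|y s] IHs x0 _.
  by exists x => [|y]; rewrite inE ?eqxx // => /eqP ->.
have [z zs zmax] := IHs y (mem_head _ _).
case: (tot x z) => xz.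
  by exists z => [|t]; rewrite inE ?zs ?orbT // => /orP[/eqP-> | /zmax].
exists x => [|t]; rewrite inE ?eqxx // => /orP[/eqP-> // | /zmax tz].
exact: trans xz.
Qed.

Section Ultrametric.
Variables (F : fieldType) (A : F -> Prop).
Hypothesis sA : subring_pred A.
Implicit Types x y z : F.

(* Comparison for the valuation whose ring is [A]. *)
Definition dom_le x y := exists2 z, A z & x = z * y.

Definition aunit x := [/\ x != 0, A x & A x^-1].

Lemma dom_le_refl x : dom_le x x.
Proof. by exists 1; rewrite ?mul1r //; case: sA. Qed.

Lemma dom_le_trans y x z : dom_le x y -> dom_le y z -> dom_le x z.
Proof.
by move=> [a Aa ->] [b Ab ->]; exists (a * b); rewrite ?mulrA //; case: sA => _ _; apply.
Qed.

Lemma dom_leD x y z : dom_le x z -> dom_le y z -> dom_le (x + y) z.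
Proof.
move=> [a Aa ->] [b Ab ->]; exists (a + b); last by rewrite mulrDl.
by case: sA => _ zA _; apply: zmod_predD.
Qed.

Lemma aunit1 : aunit 1.
Proof. by have [A1 _ _] := sA; split; rewrite ?oner_eq0 ?invr1. Qed.

Lemma aunitM x y : aunit x -> aunit y -> aunit (x * y).
Proof.
have [_ _ AM] := sA; move=> [x0 Ax Ax'] [y0 Ay Ay'].
by split; [rewrite mulf_neq0 | apply: AM | rewrite invfM; apply: AM].
Qed.

Lemma aunitX x (n : int) : aunit x -> aunit (x ^ n).
Proof.
have aX (k : nat) y : aunit y -> aunit (y ^+ k).
  by move=> uy; elim: k => [|k IHk]; rewrite ?expr0 ?exprS; [exact: aunit1 | exact: aunitM].
move=> ux; case: n => k; first exact: aX.
by rewrite NegzE -exprz_inv; apply: aX; case: ux => x0 Ax Ax'; split; rewrite ?invr_eq0 ?invrK.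
Qed.

Lemma aunit_prod (I : Type) (r : seq I) (P : pred I) (f : I -> F) :
  (forall i, P i -> aunit (f i)) -> aunit (\prod_(i <- r | P i) f i).
Proof. by apply: big_ind; [exact: aunit1 | exact: aunitM]. Qed.

Variables (V : finType) (gam : V -> F).
Let del u v := gam u - gam v.
Hypothesis dom_total : forall u v u' v',
  dom_le (del u v) (del u' v') \/ dom_le (del u' v') (del u v).

Fixpoint ultrametric (t : btree V) : Prop := match t with
  | Leaf _ => True
  | Node l r => [/\ exists D, forall u v, u \in leaves l -> v \in leaves r ->
                      dom_le (del u v) D /\ dom_le D (del u v),
                    ultrametric l & ultrametric r]
  end.

(** The root splits [s] into the open ball around [u0] whose radius is the maximal distance,
    attained between [u0] and [v0], and its complement. *)
Lemma ultrametric_tree (s : seq V) : uniq s -> s != [::] ->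
  exists2 t, perm_eq (leaves t) s & ultrametric t.
Proof.
have [k] := ubnP (size s); elim: k s => // k IHk [//|u1 [|v1 s0]].
  by exists (Leaf u1).
set s := [:: u1, v1 & s0] => le_k us _.
pose ps := [seq p <- [seq (u, v) | u <- s, v <- s] | p.1 != p.2].
pose R p q := dom_le (del p.1 p.2) (del q.1 q.2).
have p1ps : (u1, v1) \in ps.
  rewrite mem_filter; apply/andP; split.
    by move: us => /= /andP[]; rewrite inE negb_or => /andP[].
  by apply: (@allpairs_f _ _ _ pair); rewrite !inE eqxx ?orbT.
have [] := @preorder_max _ R ps _ _ _ p1ps.
- by move=> p q; apply: dom_total.
- by move=> q p r; apply: dom_le_trans.
move=> [u0 v0] p0 pmax; move: p0; rewrite /ps mem_filter => /andP[uv0].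
move=> /allpairsP[[u0' v0'] /= [u0s v0s [eu ev]]].
subst u0' v0'; rewrite /= in uv0.
have {}pmax u v : u \in s -> v \in s -> dom_le (del u v) (del u0 v0).
  move=> us' vs'; have [-> | ne] := eqVneq u v.
    exists 0; last by rewrite /del subrr mul0r.
    by case: sA => _ [].
  by apply: (pmax (u, v)); rewrite /ps mem_filter ne; apply: (@allpairs_f _ _ _ pair).
have [s1 [s2 [eqs P1 P2]]] := classic_partition
  (* The case [v = u0] is separate because the maximal difference may be 0, which is dominated by
     everything. *)
  (fun v => v = u0 \/ ~ dom_le (del u0 v0) (del u0 v)) s.
have us12 : uniq (s1 ++ s2) by rewrite (perm_uniq eqs).
have sz : (size s1 + size s2)%N = size s by rewrite -size_cat (perm_size eqs).
have u0s1 : u0 \in s1.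
  have : u0 \in s1 ++ s2 by rewrite (perm_mem eqs).
  by rewrite mem_cat => /orP[// | /P2 []]; left.
have v0s2 : v0 \in s2.
  have : v0 \in s1 ++ s2 by rewrite (perm_mem eqs).
  rewrite mem_cat => /orP[/P1 [e | []] | //]; first by rewrite e eqxx in uv0.
  exact: dom_le_refl.
have s1n : s1 != [::] by case: (s1) u0s1.
have s2n : s2 != [::] by case: (s2) v0s2.
move: us12; rewrite cat_uniq => /and3P[us1 _ us2].
have sz1 : (0 < size s1)%N by rewrite lt0n size_eq0.
have sz2 : (0 < size s2)%N by rewrite lt0n size_eq0.
have [|t1 eq1 U1] := IHk s1 _ us1 s1n.
  by rewrite -ltnS (leq_trans _ le_k) // ltnS -sz -[X in (X < _)%N]addn0 ltn_add2l.
have [|t2 eq2 U2] := IHk s2 _ us2 s2n.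
  by rewrite -ltnS (leq_trans _ le_k) // ltnS -sz -[X in (X < _)%N]add0n ltn_add2r.
exists (Node t1 t2); first by rewrite /= (perm_trans (perm_cat eq1 eq2)).
split=> //; exists (del u0 v0) => u v; rewrite (perm_mem eq1) (perm_mem eq2) => u1s v2s.
have s12 (y : V) : (y \in s1) || (y \in s2) -> y \in s by rewrite -(perm_mem eqs) mem_cat.
split; first by apply: pmax; rewrite s12 ?u1s ?v2s ?orbT.
have Dv : dom_le (del u0 v0) (del u0 v).
  by apply: NNPP => nD; apply: (P2 v v2s); right.
case: (P1 u u1s) => [-> // | nDu].
(* A sum is dominated by its larger term, and this term cannot be [del u0 u], which is strictly
   smaller than the maximum. *)
have uvE : del u0 v = del u0 u + del u v by rewrite /del addrA subrK.
case: (dom_total u0 u u v) => le.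
  apply: (dom_le_trans Dv); rewrite uvE; apply: dom_leD => //; exact: dom_le_refl.
case: nDu; apply: (dom_le_trans Dv); rewrite uvE; apply: dom_leD => //; exact: dom_le_refl.
Qed.

Variable w : V -> V -> int.
Hypothesis w_del : forall u v, w u v != 0 -> del u v != 0.

Let Psi s1 s2 := \prod_(u <- s1) \prod_(v <- s2) del u v ^ w u v.

(** All differences across have the value of [D], and since the exponents sum to zero each factor
    may be divided by [D]. If [D = 0], all the exponents vanish by [w_del]. *)
Lemma ultrametric_cross_unit D s1 s2 : cross w s1 s2 = 0 ->
  (forall u v, u \in s1 -> v \in s2 -> dom_le (del u v) D /\ dom_le D (del u v)) ->
  aunit (Psi s1 s2).
Proof.
move=> w0 sim.
have unit_ratio u v : u \in s1 -> v \in s2 -> w u v != 0 -> D != 0 /\ aunit (del u v / D).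
  move=> us vs /w_del d0; have [[a Aa ea] [b Ab eb]] := sim u v us vs.
  have D0 : D != 0 by apply: contraNneq d0 => D0; rewrite ea D0 mulr0.
  have aE : del u v / D = a by rewrite ea mulfK.
  split=> //; split; first by rewrite mulf_neq0 ?invr_eq0.
    by rewrite aE.
  by rewrite invf_div {1}eb mulfK.
have -> : Psi s1 s2 = \prod_(u <- s1) \prod_(v <- s2) (del u v / D) ^ w u v.
  have [D0 | D0] := eqVneq D 0.
    rewrite /Psi [LHS]big_seq [RHS]big_seq; apply: eq_bigr => u us.
    rewrite [LHS]big_seq [RHS]big_seq; apply: eq_bigr => v vs.
    have [-> | /(unit_ratio _ _ us vs)[]] := eqVneq (w u v) 0; first by rewrite !expr0z.
    by rewrite D0 eqxx.
  have DE : \prod_(u <- s1) \prod_(v <- s2) D ^ w u v = 1.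
    rewrite -[RHS](expr0z D) -w0 /cross.
    have sumz (I : Type) (r : seq I) (f : I -> int) :
        \prod_(i <- r) D ^ f i = D ^ (\sum_(i <- r) f i).
      by apply: (big_rec2 (fun p q => p = D ^ q)) => // i p q _ ->; rewrite expfzDr.
    by rewrite -sumz; apply: eq_bigr => u _; rewrite sumz.
  rewrite -[RHS]mulr1 -[X in _ = _ * X]DE -big_split; apply: eq_bigr => u _ /=.
  by rewrite -big_split; apply: eq_bigr => v _; rewrite /= -expfzMl divfK.
rewrite big_seq; apply: aunit_prod => u us; rewrite big_seq; apply: aunit_prod => v vs.
have [-> | /(unit_ratio _ _ us vs)[_]] := eqVneq (w u v) 0; last exact: aunitX.
by rewrite expr0z; apply: aunit1.
Qed.

Lemma ultrametric_balanced_unit t : (forall u v, w u v = w v u) ->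
  ultrametric t -> balanced w t -> aunit (Psi (leaves t) (leaves t)).
Proof.
move=> wsym; elim: t => [v _ _ | l IHl r IHr /= [[D simD] Ul Ur] [w0 bl br]] /=.
  rewrite /Psi !big_seq1.
  have [-> | /w_del] := eqVneq (w v v) 0; first by rewrite expr0z; apply: aunit1.
  by rewrite /del subrr eqxx.
have -> : Psi (leaves l ++ leaves r) (leaves l ++ leaves r) =
    Psi (leaves l) (leaves l) * Psi (leaves l) (leaves r) *
    (Psi (leaves r) (leaves l) * Psi (leaves r) (leaves r)).
  by rewrite /Psi big_cat; congr (_ * _); rewrite -big_split;
     apply: eq_bigr => u _; rewrite big_cat.
apply: aunitM; apply: aunitM; [exact: IHl | | | exact: IHr].
  exact: ultrametric_cross_unit simD.
apply: (@ultrametric_cross_unit D); first by rewrite (cross_sym _ _ wsym).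
move=> u v ur vl; have [[a Aa ea] [b Ab eb]] := simD v u vl ur.
have AN x : A x -> A (- x).
  by have [_ [A0 AB] _] := sA => Ax; rewrite -sub0r; apply: AB.
rewrite -[del u v]opprB -/(del v u); split; [exists (- a) | exists (- b)]; try exact: AN.
  by rewrite {1}ea mulNr.
by rewrite mulrNN.
Qed.

(** The scalings [lam u] cancel, since the total exponent of each is a multiple of
    [\sum_v w u v]. *)
Lemma balanced_product_unit (lam : V -> F) t : perm_eq (leaves t) (enum V) ->
  (forall u, lam u != 0) -> (forall u v, w u v = w v u) ->
  (forall u, \sum_v w u v = 0) -> ultrametric t -> balanced w t ->
  aunit (\prod_u \prod_v (lam u * lam v * (gam u - gam v)) ^ w u v).
Proof.
move=> eqt lam0 wsym w0 Ut bt; have := ultrametric_balanced_unit wsym Ut bt.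
have sumz x (f : V -> int) : x != 0 -> \prod_i x ^ f i = x ^ (\sum_i f i).
  move=> x0; apply: (big_rec2 (fun p q => p = x ^ q)); first by rewrite expr0z.
  by move=> i p q _ ->; rewrite expfzDr.
have lam1 : \prod_u \prod_v lam u ^ w u v = 1.
  by apply: big1 => u _; rewrite sumz // w0 expr0z.
have lam2 : \prod_u \prod_v lam v ^ w u v = 1.
  rewrite exchange_big -[RHS]lam1; apply: eq_bigr => u _.
  by apply: eq_bigr => v _; rewrite wsym.
have -> : Psi (leaves t) (leaves t) = \prod_u \prod_v del u v ^ w u v.
  rewrite /Psi (perm_big _ eqt) big_enum; apply: eq_bigr => u _ /=.
  by rewrite (perm_big _ eqt) big_enum.
suff -> : \prod_u \prod_v (lam u * lam v * (gam u - gam v)) ^ w u v =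
    \prod_u \prod_v lam u ^ w u v * \prod_u \prod_v lam v ^ w u v *
    \prod_u \prod_v del u v ^ w u v by rewrite lam1 lam2 !mul1r.
rewrite -!big_split /=; apply: eq_bigr => u _.
by rewrite -!big_split /=; apply: eq_bigr => v _; rewrite !expfzMl.
Qed.

End Ultrametric.

(** * From independence to orientations *)

Lemma injective_system_right_inverse (F : fieldType) (I J : finType) (q : I -> J -> F) :
  injective_system q -> exists P : J -> I -> F,
    forall i i', \sum_j q i j * P j i' = (i == i')%:R.
Proof.
move=> /injective_system_row_free /row_freeP [Q qQ].
exists (fun j i => Q (enum_rank j) (enum_rank i)) => i i'.
have := congr1 (fun X : 'M_#|I| => X (enum_rank i) (enum_rank i')) qQ.
rewrite !mxE (inj_eq enum_rank_inj) => <-.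
rewrite (reindex enum_rank) /=; last exact/onW_bij/enum_rank_bij.
by apply: eq_bigr => j _; rewrite mxE !enum_rankK.
Qed.

(** The part of order at least two in the bracket of two perturbed points, divided by ['X^2]. *)
Definition bracket_remainder (R : comNzRingType) (a1 b1 p0 p1 q0 q1 : R) : {poly R} :=
  b1%:P - a1%:P + (p0%:P * q1%:P - p1%:P * q0%:P) + 'X * (q1%:P - p1%:P).

Lemma bracket_expansion (R : comNzRingType) (a0 a1 b0 b1 p0 p1 q0 q1 : R) :
  (a0%:P + 'X * p0%:P + 'X^2) * (b1%:P + 'X * q1%:P) -
  (a1%:P + 'X * p1%:P) * (b0%:P + 'X * q0%:P + 'X^2) =
  (a0 * b1 - a1 * b0)%:P +
  'X * ((p0 * b1 - p1 * b0 + (a0 * q1 - a1 * q0))%:P +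
    'X * bracket_remainder a1 b1 p0 p1 q0 q1).
Proof. by rewrite /bracket_remainder !(polyCD, polyCB, polyCM); ring. Qed.

Lemma quadratic_neq0 (R : comNzRingType) (a p : R) :
  a%:P + 'X * p%:P + 'X^2 != 0 :> {poly R}.
Proof.
apply/eqP => /(congr1 (fun r : {poly R} => r`_2)).
rewrite !coefD !coefC coefXM coefC coefXn /= !add0r.
by apply/eqP; rewrite oner_eq0.
Qed.

Lemma bracket_derivative (R : comNzRingType) (a0 a1 b0 b1 p0 p1 q0 q1 x : R) :
  p0 * x * b1 - p1 * x * b0 + (a0 * (q1 * x) - a1 * (q0 * x)) =
  (p0 * b1 - p1 * b0 + (a0 * q1 - a1 * q0)) * x.
Proof. by ring. Qed.

Section RigidityOrientation.
Variables (K : fieldType) (m n : nat) (E : {set 'I_m * 'I_n}).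
Variables (A : 'M[K]_(m, 2)) (B : 'M[K]_(n, 2)).
Hypothesis rig : rigidity_independent E A B.

(** A right inverse of the rigidity matrix provides, for each [e'] in [E], a motion of the points
    that varies the bracket of [e'] and, to first order, no other bracket of [E]. *)
Lemma rigidity_tangent : exists (P : 'I_m -> 'I_2 -> 'I_m * 'I_n -> K)
    (Q : 'I_n -> 'I_2 -> 'I_m * 'I_n -> K),
  forall e e', e \in E ->
    P e.1 0 e' * B e.2 1 - P e.1 1 e' * B e.2 0 +
    (A e.1 0 * Q e.2 1 e' - A e.1 1 * Q e.2 0 e') = (e == e')%:R.
Proof.
pose q (e : 'I_m * 'I_n) (f : 'I_2 * 'I_n + 'I_m * 'I_2 + 'I_m * 'I_n) : K :=
  match f with
  | inl (inl f) => A e.1 f.1 *+ (e.2 == f.2)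
  | inl (inr f) => B e.2 f.2 *+ (e.1 == f.1)
  | inr f => ((e == f) && (e \notin E))%:R
  end.
have inj : injective_system q.
  move=> y y0.
  have : \matrix_(i, j) y (i, j) = 0.
    apply: rig => [e eE | |].
    - rewrite mxE -surjective_pairing -[RHS](y0 (inr e)) (bigD1 e) //= eqxx eE mulr1.
      by rewrite big1 ?addr0 // => f /negPf ->; rewrite mulr0.
    - apply/matrixP => k j; rewrite !mxE -[RHS](y0 (inl (inl (k, j)))) /=.
      transitivity (\sum_i \sum_j' y (i, j') * (A i k *+ (j' == j))).
        apply: eq_bigr => i _; rewrite (bigD1 j) //= eqxx !mxE mulrC big1 ?addr0 //.
        by move=> j' /negPf ->; rewrite mulr0.
      by rewrite pair_bigA; apply: eq_bigr => -[].
    - apply/matrixP => i k; rewrite !mxE -[RHS](y0 (inl (inr (i, k)))) /=.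
      transitivity (\sum_i' \sum_j y (i', j) * (B j k *+ (i' == i))).
        rewrite (bigD1 i) //= [X in _ + X]big1 ?addr0 => [|i' /negPf ne].
          by apply: eq_bigr => j _; rewrite eqxx !mxE.
        by rewrite big1 // => j _; rewrite ne mulr0.
      by rewrite pair_bigA; apply: eq_bigr => -[].
  by move=> y_0 [i j]; move/matrixP/(_ i j): y_0; rewrite !mxE.
have [R qR] := injective_system_right_inverse inj.
(* The swap of indices and the signs come from the gradient of a 2 by 2 determinant. *)
exists (fun i k e' => if k == 0 then R (inl (inr (i, 1))) e' else - R (inl (inr (i, 0))) e').
exists (fun j k e' => if k == 0 then - R (inl (inl (1, j))) e' else R (inl (inl (0, j))) e').
move=> e e' eE; rewrite -qR !big_sumType /=.
rewrite [X in _ = _ + X]big1 => [|f _]; last by rewrite eE andbF mul0r.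
have -> : \sum_(f : 'I_2 * 'I_n) A e.1 f.1 *+ (e.2 == f.2) * R (inl (inl f)) e' =
    \sum_k A e.1 k * R (inl (inl (k, e.2))) e'.
  transitivity (\sum_k \sum_j A e.1 k *+ (e.2 == j) * R (inl (inl (k, j))) e').
    by rewrite pair_bigA; apply: eq_bigr => -[].
  apply: eq_bigr => k _; rewrite (bigD1 e.2) //= eqxx big1 ?addr0 // => j ne.
  by rewrite eq_sym (negPf ne) mul0r.
have -> : \sum_(f : 'I_m * 'I_2) B e.2 f.2 *+ (e.1 == f.1) * R (inl (inr f)) e' =
    \sum_k B e.2 k * R (inl (inr (e.1, k))) e'.
  transitivity (\sum_i \sum_k B e.2 k *+ (e.1 == i) * R (inl (inr (i, k))) e').
    by rewrite pair_bigA; apply: eq_bigr => -[].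
  rewrite (bigD1 e.1) //= [X in _ + X]big1 ?addr0 => [|i ne].
    by apply: eq_bigr => k _; rewrite eqxx.
  by rewrite big1 // => k _; rewrite eq_sym (negPf ne) mul0r.
rewrite !big_ord_recl !big_ord0.
have -> : lift ord0 ord0 = 1 :> 'I_2 by apply: val_inj.
by rewrite /=; ring.
Qed.

Let V : finType := ('I_m + 'I_n)%type.
Let N := #|{: 'I_m * 'I_n}|.
Let T := {poly {mpoly K[N]}}.

(* Vectors [x v] with coordinates [xa v, xb v], moving away from the rows of
   [A] and [B] in such a way that the first-order variations of the brackets of
   the edges are independent indeterminates; the second-order term only makes
   the first coordinates nonzero. *)
Lemma perturbed_points :
  exists (xa xb : V -> T) (c : 'I_m * 'I_n -> K) (z : 'I_m * 'I_n -> T),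
  (forall v, xa v != 0) /\
  forall e, e \in E ->
    xa (inl e.1) * xb (inr e.2) - xb (inl e.1) * xa (inr e.2) =
    ((c e)%:MP)%:P + 'X * (('X_(enum_rank e))%:P + 'X * z e).
Proof.
have [P [Q PQ]] := rigidity_tangent.
pose lin (f : 'I_m * 'I_n -> K) : {mpoly K[N]} := \sum_e' (f e')%:MP * 'X_(enum_rank e').
pose a k (v : V) : K := match v with inl i => A i k | inr j => B j k end.
pose p k (v : V) := match v with inl i => lin (P i k) | inr j => lin (Q j k) end.
pose x k v : T := ((a k v)%:MP)%:P + 'X * (p k v)%:P.
exists (fun v => x 0 v + 'X^2), (fun v => x 1 v).
exists (fun e => a 0 (inl e.1) * a 1 (inr e.2) - a 1 (inl e.1) * a 0 (inr e.2)).
exists (fun e => let i := inl e.1 in let j := inr e.2 in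
  bracket_remainder (a 1 i)%:MP (a 1 j)%:MP (p 0 i) (p 1 i) (p 0 j) (p 1 j)).
split=> [v | e eE]; first exact: quadratic_neq0.
pose i := inl e.1 : V; pose j := inr e.2 : V.
have tangent : p 0 i * (a 1 j)%:MP - p 1 i * (a 0 j)%:MP +
    ((a 0 i)%:MP * p 1 j - (a 1 i)%:MP * p 0 j) = 'X_(enum_rank e).
  rewrite /p /= /lin !mulr_suml !mulr_sumr -!sumrN -!big_split /=.
  transitivity (\sum_e' ((e == e')%:R : K)%:MP * 'X_(enum_rank e') : {mpoly K[N]}).
    apply: eq_bigr => e' _; rewrite bracket_derivative; congr (_ * _).
    by rewrite -(PQ _ e' eE) mpolyCD !mpolyCB !mpolyCM.
  rewrite (bigD1 e) //= eqxx mpolyC1 mul1r big1 ?addr0 // => e' ne.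
  by rewrite eq_sym (negPf ne) mpolyC0 mul0r.
have := bracket_expansion (a 0 i)%:MP (a 1 i)%:MP (a 0 j)%:MP (a 1 j)%:MP
  (p 0 i) (p 1 i) (p 0 j) (p 1 j).
by rewrite tangent -!mpolyCM -mpolyCB.
Qed.

End RigidityOrientation.

(** * From independent brackets to an orientation *)

Section BracketOrientation.
Variables (m n : nat) (E : {set 'I_m * 'I_n}).
Let V : finType := ('I_m + 'I_n)%type.
Let N := #|{: 'I_m * 'I_n}|.
Variables (K F : fieldType) (iota : {rmorphism K -> F}) (xa xb : V -> F) (M : 'I_N -> F).
Hypothesis xa_neq0 : forall v, xa v != 0.
Hypothesis M_bracket : forall e, e \in E ->
  M (enum_rank e) = xa (inl e.1) * xb (inr e.2) - xb (inl e.1) * xa (inr e.2).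
Hypothesis ind : forall f : {mpoly K[N]}, mmap iota M f = 0 -> f = 0.

(** Minus the slope, so that brackets are positive multiples [xa u * xa v] of [gam u - gam v] in the
    order of [M_bracket]. *)
Let gam v := - (xb v / xa v).

Let M_neq0 k : M k != 0.
Proof.
apply/eqP => M0; have /ind : mmap iota M 'X_k = 0 by rewrite mmapX mmap1U.
by move/(congr1 (mcoeff U_(k)%MM)); rewrite mcoeffX eqxx mcoeff0; apply/eqP; rewrite oner_eq0.
Qed.

Let M_gam e : e \in E -> M (enum_rank e) =
  xa (inl e.1) * xa (inr e.2) * (gam (inl e.1) - gam (inr e.2)).
Proof.
move=> eE; rewrite M_bracket // /gam.
have := xa_neq0 (inl e.1); have := xa_neq0 (inr e.2).
move: (xa _) (xa _) => p q p0 q0.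
by field; rewrite p0.
Qed.

Let circulation_edge w u v : circulation E w -> w u v != 0 -> bip_graph E u v.
Proof. by case=> _ wE _; apply: contraR => /wE ->. Qed.

(** Each edge occurs once in each direction, with opposite brackets: hence the squares and the
    signs. *)
Lemma circulation_product w : circulation E w ->
  \prod_u \prod_v (xa u * xa v * (gam u - gam v)) ^ w u v =
  \prod_(k < N) (- 1) ^ w (inl (enum_val k).1) (inr (enum_val k).2) *
  \prod_(k < N) (M k ^ w (inl (enum_val k).1) (inr (enum_val k).2)) ^+ 2.
Proof.
move=> cw; have [wsym wE _] := cw.
pose G u v := (xa u * xa v * (gam u - gam v)) ^ w u v.
have Gl i : \prod_v G (inl i) v = \prod_j G (inl i) (inr j).
  rewrite big_sumType /= big1 ?mul1r // => i' _.
  by rewrite /G wE ?expr0z.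
have Gr j : \prod_v G (inr j) v = \prod_i G (inr j) (inl i).
  rewrite big_sumType /= mulrC big1 ?mul1r // => j' _.
  by rewrite /G wE ?expr0z.
rewrite -/(\prod_u \prod_v G u v) big_sumType /=.
under eq_bigr => i _ do rewrite Gl.
under [X in _ * X]eq_bigr => j _ do rewrite Gr.
rewrite [X in _ * X]exchange_big -big_split /=.
under eq_bigr => i _ do rewrite -big_split /=.
rewrite pair_bigA /= -big_split /= (reindex (@enum_val _ {: 'I_m * 'I_n})) /=; last first.
  exact/onW_bij/enum_val_bij.
apply: eq_bigr => k _; rewrite -[in RHS](enum_valK k) enum_rankK; move: (enum_val k) => e.
have [eE | eE] := boolP (e \in E); last first.
  have w0 : w (inl e.1) (inr e.2) = 0 by apply: wE; rewrite /= -surjective_pairing.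
  by rewrite /G [w (inr _) _]wsym w0 !expr0z expr1n !mulr1.
rewrite /G [w (inr _) _]wsym (M_gam eE) expr2 mulrCA; congr (_ * _).
rewrite -expfzMl; congr (_ ^ _); rewrite mulN1r -mulrN opprB.
by rewrite [xa (inr _) * _]mulrC.
Qed.

Lemma bracket_orientation : (0 < m)%N ->
  exists d : rel V,
    [/\ orientation (bip_graph E) d,
        forall c, ~ directed_cycle (bip_graph E) d c &
        forall c, ~ alternating_cycle (bip_graph E) d c].
Proof.
move=> m_gt0.
pose del (p : V * V) := gam p.1 - gam p.2.
(* Domination between differences of slopes is total as soon as the ring contains each of these
   ratios or its inverse. *)
pose rs := [seq r <- [seq del p / del q | p <- enum {: V * V}, q <- enum {: V * V}] | r != 0].
have rs0 : 0 \notin rs by rewrite mem_filter eqxx.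
have [A [sA As sep]] := separating_ring ind rs0.
have A0 : A 0 by have [_ [? _] _] := sA.
have dom_total u v u' v' : dom_le A (gam u - gam v) (gam u' - gam v') \/
    dom_le A (gam u' - gam v') (gam u - gam v).
  have [d0 | d0] := eqVneq (gam u - gam v) 0; first by left; exists 0; rewrite ?d0 ?mul0r.
  have [d0' | d0'] := eqVneq (gam u' - gam v') 0; first by right; exists 0; rewrite ?d0' ?mul0r.
  have /As[Ar | Ar] : (gam u - gam v) / (gam u' - gam v') \in rs.
  - rewrite mem_filter mulf_neq0 ?invr_eq0 // andTb.
    by apply/allpairsP; exists ((u, v), (u', v')); split; rewrite ?mem_enum.
  - by left; exists ((gam u - gam v) / (gam u' - gam v')); rewrite ?divfK.
  - by right; exists ((gam u - gam v) / (gam u' - gam v'))^-1 => //; rewrite invf_div divfK.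
have [|t eqt Ut] := ultrametric_tree sA dom_total (enum_uniq V).
  have : inl (Ordinal m_gt0) \in enum V by rewrite mem_enum.
  by case: (enum V).
have [|s eqs inds] := @caterpillar V (circulation E) [:: t] (weight_module_circulation E).
  move=> w cw [_ bt _].
  suff w0 e : w (inl e.1) (inr e.2) = 0.
    have [wsym wE _] := cw.
    move=> [i|j] [i'|j']; [exact: wE | exact: (w0 (i, j')) | | exact: wE].
    by rewrite wsym; apply: (w0 (i', j)).
  apply/eqP/negPn/negP => we.
  have [wsym wE w0] := cw.
  have w_del u v : w u v != 0 -> gam u - gam v != 0.
    move=> /(circulation_edge cw); case: u v => [i|j] [i'|j'] //= ijE.
      by have := M_neq0 (enum_rank (i, j')); rewrite M_gam // mulf_eq0 negb_or => /andP[].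
    have := M_neq0 (enum_rank (i', j)); rewrite M_gam // mulf_eq0 negb_or => /andP[_].
    by rewrite -opprB oppr_eq0.
  have := balanced_product_unit sA w_del eqt xa_neq0 wsym w0 Ut bt.
  rewrite circulation_product //.
  pose wk (k : 'I_N) := w (inl (enum_val k).1) (inr (enum_val k).2).
  rewrite -/(\prod_(k < N) (-1) ^ wk k) -/(\prod_(k < N) (M k ^ wk k) ^+ 2) => uP.
  set Q := \prod_(k < N) (M k ^ wk k) ^+ 2 in uP.
  have uN1 : aunit A (-1).
    have AN1 : A (-1) by have [A1 [_ AB] _] := sA; rewrite -sub0r; apply: AB.
    by split; rewrite ?oppr_eq0 ?oner_eq0 ?invrN1.
  have {uP} uQ : aunit A Q.
    rewrite -[Q]mul1r -(mulVf (_ : \prod_(k < N) (-1) ^ wk k != 0)).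
      rewrite -mulrA; apply: aunitM => //; rewrite -prodfV; apply: aunit_prod => // k _.
      by rewrite invr_expz; apply: aunitX.
    by apply/prodf_neq0 => k _; rewrite expfz_neq0 // oppr_eq0 oner_eq0.
  (* The positive and negative parts of the exponents [2 * wk k]: the unit [Q] becomes a quotient of
     two monomials, distinct because [w] is nonzero on [e], which contradicts [sep]. *)
  pose a := [multinom (if wk k is Posz p then (p * 2)%N else 0%N) | k < N].
  pose b := [multinom (if wk k is Negz p then (p.+1 * 2)%N else 0%N) | k < N].
  have abQ : mmap1 M a = Q * mmap1 M b.
    rewrite /Q -big_split; apply: eq_bigr => k _ /=; rewrite !mnmE.
    case: (wk k) => p /=; first by rewrite expr0 mulr1 exprM.
    by rewrite NegzE -exprnN exprVn -exprM mulVf // expf_neq0.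
  case: uQ => Q0 AQ AQ'.
  apply: (sep a b Q Q^-1 _ AQ AQ' abQ); last by rewrite abQ mulKf.
  apply/eqP => /mnmP/(_ (enum_rank e)); rewrite !mnmE /wk enum_rankK.
  by move: (w _ _) we => [[|p]|p].
apply: (order_orientation _ inds); apply: (perm_trans eqs).
by rewrite /forest_leaves /= cats0.
Qed.

End BracketOrientation.

Lemma rigidity_orientation (K : fieldType) (m n : nat) (E : {set 'I_m * 'I_n})
    (A : 'M[K]_(m, 2)) (B : 'M[K]_(n, 2)) :
  (0 < m)%N -> rigidity_independent E A B ->
  exists d : rel ('I_m + 'I_n),
    [/\ orientation (bip_graph E) d,
        forall c, ~ directed_cycle (bip_graph E) d c &
        forall c, ~ alternating_cycle (bip_graph E) d c].
Proof.
move=> m_gt0 rig; have [xa [xb [c [z [xa0 xE]]]]] := perturbed_points rig.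
pose N := #|{: 'I_m * 'I_n}|.
pose T := {poly {mpoly K[N]}}.
pose iota : {rmorphism K -> T} := polyC \o @mpolyC N K.
(* Every pair receives an element of this shape; those in [E] are brackets. *)
pose M0 (k : 'I_N) (e : 'I_m * 'I_n) : T := iota (c e) + 'X * (('X_k)%:P + 'X * z e).
pose M (k : 'I_N) : {fraction T} := tofrac (M0 k (enum_val k)).
apply: (@bracket_orientation _ _ E K {fraction T} (@tofrac T \o iota)
          (fun v => tofrac (xa v)) (fun v => tofrac (xb v)) M) => //.
- by move=> v; rewrite tofrac_eq0.
- move=> e eE; rewrite -!tofracM -tofracB (xE e eE).
  exact: (congr1 (fun e' => @tofrac T (M0 (enum_rank e) e')) (enum_rankK e)).
move=> f f0; apply: (@alg_independent_perturbation _ _ (c \o enum_val) (z \o enum_val)).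
by apply/eqP; rewrite -tofrac_eq0 mmap_rmorph; apply/eqP; rewrite -[RHS]f0.
Qed.

Lemma correctable_image_code (K : fieldType) (m n s r : nat) (E : {set 'I_m * 'I_n})
    (U : 'M[K]_(m, s)) (V : 'M[K]_(n, r)) : \rank U = s -> \rank V = r ->
  correctable (image_code U V) E <-> no_codeword_in E U V.
Proof.
move=> rU rV; split=> [cor B B0 | noc M M' /image_codeP[B ->] /image_codeP[B' ->] eqE].
  have : U *m B *m V^T = 0.
    apply: cor => [||e eE]; [by apply/image_codeP; exists B | exact: mem0v |].
    by rewrite B0 // mxE.
  rewrite -mulmxA => /(full_rank_mulmxI rU) BV.
  rewrite -[B]trmxK (full_rank_mulmxI rV (_ : V *m B^T = 0)) ?trmx0 //.
  by rewrite -[V]trmxK -trmx_mul BV trmx0.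
have /eqP : B - B' = 0.
  by apply: noc => e eE; rewrite mulmxBr mulmxBl mxE [X in _ + X]mxE eqE // subrr.
by rewrite subr_eq0 => /eqP ->.
Qed.

Theorem proposition1p8 (m n : nat) (hm : (2 <= m)%N) (hn : (2 <= n)%N)
    (k : finFieldType) (p : nat) (hp : p \in [pchar k])
    (C : {vspace 'M[k]_(m, n)}) (hC : mr_tensor_code p 2 2 C)
    (E : {set 'I_m * 'I_n}) :
  correctable C E <->
  exists d : rel ('I_m + 'I_n),
    [/\ orientation (bip_graph E) d,
        forall c, ~ directed_cycle (bip_graph E) d c &
        forall c, ~ alternating_cycle (bip_graph E) d c].
Proof.
have [K [U [V [_ ind ->]]]] := mr_tensor_code_correctable hC.
have rU := generic_full_rankl idfun ind (leq_subr 2 m).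
have rV := generic_full_rankr idfun ind (leq_subr 2 n).
rewrite correctable_image_code //; split=> [noc | [d [ori acy noalt]]].
  have [A [B rig]] := no_codeword_rigidity hm hn rU rV noc.
  exact: rigidity_orientation (ltnW hm) rig.
have [A [B rig]] := orientation_rigidity K ori acy noalt.
have [U' [V' noc]] := rigidity_no_codeword hm hn rig.
(* The special point lives over [K(t)], an extension of [K], from which the property passes to the
   generic vectors. *)
exact: (generic_no_codeword (@tofrac {poly K} \o polyC) ind noc).
Qed.
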